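(* There are absolute constants $c$ and $\kappa$ such that for every integer $d\ge 1$, every projective 3-fold $X\subset\mathbb{P}^4_{\mathbb{Q}}$ of degree $d$ and every real $B\ge 2$ one has $$\#X(\mathbb{Q},B)\le c\,d^{\frac{48}{55}}B^4(\log B)^{\kappa}.$$
   Context: A variety in $\mathbb{P}^n_{\mathbb{Q}}$ is a reduced (closed) subscheme of $\mathbb{P}^n_{\mathbb{Q}}$, not necessarily irreducible; a 3-fold is a variety of pure dimension $3$, and its degree is the sum of the degrees of its irreducible components. $X(\mathbb{Q},B)$ denotes the set of rational points of $X$ of height $\le B$, i.e. the points that can be written in homogeneous integer coordinates $(x_0,\dots,x_n)$ (not all zero) with $|x_0|,\dots,|x_n|\le B$. *)

(* Defs.v *)
From HB Require Import structures.
From mathcomp Require Import all_boot all_order all_algebra.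
From mathcomp Require Import mpoly.
From mathcomp Require Import classical_sets cardinality reals exp.

Set Implicit Arguments.
Unset Strict Implicit.
Unset Printing Implicit Defensive.

Import Order.TTheory GRing.Theory Num.Theory.
Local Open Scope ring_scope.

(* Closed subschemes of P^n_Q are described by ideals of the homogeneous
   coordinate ring {mpoly rat[n.+1]}.  Ideals are boolean predicates compared
   extensionally ([=i] and [{subset _ <= _}]). *)

Definition homog_ideal n (I : {pred {mpoly rat[n]}}) : Prop :=
  idealr_closed I /\
  forall (f : {mpoly rat[n]}) (k : nat),
    f \in I -> pihomog mdeg k f \in I.

Definition radical_closed n (I : {pred {mpoly rat[n]}}) : Prop :=
  forall (f : {mpoly rat[n]}) (k : nat), f ^+ k \in I -> f \in I.

(* Reduced closed subschemes of P^n_Q correspond bijectively to proper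
   homogeneous radical ideals: such an ideal is automatically saturated, unless
   it is the irrelevant ideal, which represents the empty scheme.
   Properness is part of [idealr_closed]. *)
Record proj_variety (n : nat) := ProjVariety {
  variety_ideal : {pred {mpoly rat[n.+1]}};
  variety_homog : homog_ideal variety_ideal;
  variety_radical : radical_closed variety_ideal
}.

(* The points of the scheme P^n_Q = Proj Q[X_0, .., X_n], equivalently its
   integral closed subschemes. *)
Definition proj_prime n (P : {pred {mpoly rat[n.+1]}}) : Prop :=
  [/\ homog_ideal P, prime_idealr_closed P & exists i, 'X_i \notin P].

Definition irr_component n (X : proj_variety n)
    (P : {pred {mpoly rat[n.+1]}}) : Prop :=
  [/\ proj_prime P,
      {subset variety_ideal X <= P} &
      forall Q : {pred {mpoly rat[n.+1]}}, proj_prime Q ->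
        {subset variety_ideal X <= Q} -> {subset Q <= P} -> Q =i P].

(* Strictly increasing chains P = Q_0 < ... < Q_r of points of P^n_Q, i.e.
   strictly decreasing chains of irreducible closed subsets of V(P). *)
Definition prime_chain n (P : {pred {mpoly rat[n.+1]}}) (r : nat) : Prop :=
  exists Q : nat -> {pred {mpoly rat[n.+1]}},
    [/\ Q 0 =i P,
        forall i, (i <= r)%N -> proj_prime (Q i) &
        forall i, (i < r)%N ->
          {subset Q i <= Q i.+1} /\ ~ {subset Q i.+1 <= Q i}].

Definition irr_dim n (P : {pred {mpoly rat[n.+1]}}) (r : nat) : Prop :=
  prime_chain P r /\ forall s, prime_chain P s -> (s <= r)%N.

Definition pure_dim n (X : proj_variety n) (r : nat) : Prop :=
  forall P, irr_component X P -> irr_dim P r.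

(* h is the dimension over Q of the degree m part of Q[X_0, .., X_n] / I;
   W is the degree m part of I. *)
Definition hilbert_value n (I : {pred {mpoly rat[n.+1]}}) (m h : nat) : Prop :=
  exists2 W : {vspace dhomog n.+1 rat m},
    (forall f : dhomog n.+1 rat m, (f \in W) = ((f : {mpoly rat[n.+1]}) \in I))
    & h = (\dim {: dhomog n.+1 rat m} - \dim W)%N.

Definition hilbert_poly n (I : {pred {mpoly rat[n.+1]}}) (H : {poly rat}) :
    Prop :=
  exists m0 : nat, forall m, (m0 <= m)%N ->
    exists2 h : nat, hilbert_value I m h & H.[m%:R] = h%:R.

(* The degree of V(P) is r! times the leading coefficient of its Hilbert
   polynomial, where r = dim V(P). *)
Definition irr_degree n (P : {pred {mpoly rat[n.+1]}}) (e : nat) : Prop :=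
  exists (r : nat) (H : {poly rat}),
    [/\ irr_dim P r, hilbert_poly P H & e%:R = r`!%:R * lead_coef H].

(* Q lists each irreducible component exactly once and e lists the degrees. *)
Definition variety_degree n (X : proj_variety n) (d : nat) : Prop :=
  exists (k : nat) (Q : 'I_k -> {pred {mpoly rat[n.+1]}}) (e : 'I_k -> nat),
    [/\ forall i, irr_component X (Q i),
        forall P, irr_component X P -> exists i, P =i Q i,
        forall i j, Q i =i Q j -> i = j,
        forall i, irr_degree (Q i) (e i) &
        d = (\sum_(i < k) e i)%N].

(* Points of P^n(Q) are the lines L of Q^(n+1). *)
Definition rat_point_on n (X : proj_variety n) (L : {vspace 'rV[rat]_(n.+1)}) :
    Prop :=
  \dim L = 1%N /\
  forall (v : 'rV[rat]_(n.+1)) (f : {mpoly rat[n.+1]}),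
    v \in L -> f \in variety_ideal X -> f.@[v 0] = 0.

Definition height_le (R : realType) n (L : {vspace 'rV[rat]_(n.+1)}) (B : R) :
    Prop :=
  exists x : 'rV[int]_(n.+1),
    [/\ x != 0,
        forall i, `|x 0 i|%:~R <= B &
        L = <[map_mx intr x]>%VS].

Definition rat_points (R : realType) n (X : proj_variety n) (B : R) :
    set {vspace 'rV[rat]_(n.+1)} :=
  [set L | rat_point_on X L /\ height_le L B]%classic.

(* Main.v *)
Require Import Defs.
From HB Require Import structures.
From mathcomp Require Import all_boot all_order all_algebra.
From mathcomp Require Import mpoly.
From mathcomp Require Import boolp classical_sets cardinality reals exp.
From mathcomp Require Import zify ring lra.

(** The rational points of X are counted on one equation, by a descent over the
rational linear subspaces on which that equation vanishes.

The equation. A component of X is a homogeneous prime P of dimension 3. Since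
polynomial rings over the rationals are factorial, a nonzero element of P of least
degree is a prime form p. If P were larger than (p), then 0 < (p) < P would extend
the chain of length 3 above P to one of length 5; but passing to a strictly larger
homogeneous prime lowers the order of growth of the Hilbert function by one, so
that chains in the projective 4-space have length at most 4 ([prime_chain_le]).
Hence P = (p), the Hilbert polynomial gives deg p = deg P, and the product F of the
forms p has degree d and vanishes at all rational points of X ([variety_equation]).

The descent. Let the height of a subspace V of Q^n be the largest maximal minor of a
basis of the integral points of V; for a line it is the height of the point, and the
orthogonal of V has the same height ([height_orth]). Two estimates hold without any
exception. A subspace of dimension k and height t <= h is contained in at most about
t (h/t)^(n-k) subspaces of dimension k+1 and height at most h ([overspaces_le]). For
h <= t, the same expression is a lower bound, when an overspace V' is counted with
multiplicity h / height V' ([overspaces_mass_ge]). Both come from the fact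
that the integral points of V project onto a sublattice of index t in a suitable
coordinate space Z^k; duality turns them into estimates for the hyperplanes of a
subspace. Call V contained when F vanishes on V. A subspace that is not contained has
at most d contained hyperplanes: a suitable line meets them in distinct zeros of a
nonzero polynomial of degree at most d ([vanishing_sections_bounded]).

Let a_k(h) be the number of contained V of dimension k and height about h. Counting
the pairs V < V' with V contained, height V about h and height V' <= h', where V' has
dimension k+1 and multiplicity h' / height V', gives up to constants
  a_k(h) h'^(n-k) / h^(n-k-1)
    <= d h'^n + sum of h^(k+1) h' / (height V')^(k+1) over the contained V'.
With h' = h / d^(1/n) and a_(n-1)(h) <= min (d, h^n), a descending induction on k
yields a_k(h) <= C d^((n-k)/n) h^(n-1); the exponent of d is recorded through a power
of two tau with d <= 2^(n tau) ([weight_bound_step]). For n = 5 and k = 1 this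
bounds the number of points by C d^(4/5) B^4, and 4/5 = 44/55 is less than 48/55, so
that kappa = 0 is possible. *)

Set Implicit Arguments.
Unset Strict Implicit.
Unset Printing Implicit Defensive.

Import Order.TTheory GRing.Theory Num.Theory.
Local Open Scope ring_scope.

(** * Unique factorization in polynomial rings *)

Section PrimeElements.
Variable R : idomainType.
Implicit Types a b c p : R.

Definition divides p a := exists c, a = c * p.

(** Divisibility of products rather than irreducibility: this is what makes (p) a prime
    ideal, and it makes the number of factors in [factors] independent of the
    factorization. *)
Definition prime_element p :=
  [/\ p != 0, p \isn't a GRing.unit & forall a b, divides p (a * b) -> divides p a \/ divides p b].

Definition factors (a : R) (s : seq R) :=
  (forall p, p \in s -> prime_element p) /\ exists2 u, u \is a GRing.unit & a = u * \prod_(p <- s) p.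

Lemma dividesD p a b : divides p a -> divides p b -> divides p (a + b).
Proof. by move=> [x ->] [y ->]; exists (x + y); rewrite mulrDl. Qed.

Lemma dividesB p a b : divides p a -> divides p b -> divides p (a - b).
Proof. by move=> [x ->] [y ->]; exists (x - y); rewrite mulrBl. Qed.

Lemma divides_mull p a b : divides p b -> divides p (a * b).
Proof. by move=> [x ->]; exists (a * x); rewrite mulrA. Qed.

Lemma prime_unit p a : prime_element p -> a \is a GRing.unit -> ~ divides p a.
Proof.
move=> [_ pu _] au [c e]; move: pu; apply/negP; rewrite negbK.
by move: au; rewrite e unitrM => /andP[].
Qed.

(** A prime dividing a product of primes is associated with one of the factors, so that
    dividing by it shortens the factorization by one: this is the termination measure
    when contents are extracted from a polynomial. *)
Lemma factors_div p a s : prime_element p -> factors (a * p) s ->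
  exists s', size s = (size s').+1 /\ factors a s'.
Proof.
move=> pp [sp [u uu e]].
have /hasP/= : has (fun q => `[< divides p q >]) s.
  apply: contrapT => /negP/hasPn h.
  have : divides p (u * \prod_(q <- s) q) by exists a.
  elim: s {e sp} u uu h => [|q s IH] u uu h.
    by rewrite big_nil mulr1; apply: prime_unit.
  rewrite big_cons mulrCA => hd; have [_ _ /(_ _ _ hd)[]] := pp.
    by move=> /asboolP; apply/negP/h; rewrite mem_head.
  by apply: IH => // q' hq'; apply: h; rewrite inE hq' orbT.
case=> q qs /asboolP[w ew].
have [q0 qu qp] := sp q qs; have [p0 pu _] := pp.
have wu : w \is a GRing.unit.
  have [|[x ex]|[x ex]] := qp w p; first by exists 1; rewrite mul1r.
    have : q * (1 - x * p) = 0 by rewrite mulrBr mulr1 mulrCA mulrA -ex -ew subrr.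
    move=> /eqP; rewrite mulf_eq0 (negPf q0) /= subr_eq0 => /eqP e1.
    by case/negP: pu; apply/unitrP; exists x; rewrite [p * x]mulrC -e1.
  have : p * (1 - x * w) = 0 by rewrite mulrBr mulr1 mulrCA mulrA mulrAC -mulrA -ew -ex subrr.
  move=> /eqP; rewrite mulf_eq0 (negPf p0) /= subr_eq0 => /eqP e1.
  by apply/unitrP; exists x; rewrite [w * x]mulrC -e1.
exists (rem q s); split; first by rewrite size_rem // prednK // lt0n size_eq0; apply: contraTneq qs => ->.
split; first by move=> q' /mem_rem /sp.
exists (u * w); first by rewrite unitrM uu.
apply: (mulIf p0); rewrite e (big_rem q) //= ew; ring.
Qed.
End PrimeElements.

Definition ufd (R : idomainType) := forall a : R, a != 0 -> exists s, factors a s.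

(** Gauss: p divides the leading coefficient of f g, hence that of f or of g;
    subtracting this leading term keeps the divisibility of the product and lowers the
    size. *)
Lemma prime_polyC (R : idomainType) (p : R) : prime_element p -> prime_element p%:P.
Proof.
move=> [p0 pu pp]; split; first by rewrite polyC_eq0.
  by rewrite poly_unitE coefC negb_and pu orbT.
have dvdX (a : R) n : divides p a -> divides p%:P (a *: 'X^n).
  by move=> [c ->]; exists (c *: 'X^n); rewrite -!mul_polyC polyCM; ring.
have lcP (f : {poly R}) : exists g : {poly R}, f = g + lead_coef f *: 'X^((size f).-1) /\ (f != 0 -> (size g < size f)%N).
  have [->|f0] := eqVneq f 0; first by exists 0; rewrite lead_coef0 scale0r addr0.
  exists (f - lead_coef f *: 'X^((size f).-1)); rewrite subrK; split=> // _.
  rewrite [ltnRHS](polySpred f0) ltnS; apply/leq_sizeP => j hj.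
  rewrite coefB coefZ coefXn; case: (eqVneq j (size f).-1) => [->|ne].
    by rewrite mulr1 subrr.
  by rewrite mulr0 subr0 nth_default // (polySpred f0) ltn_neqAle eq_sym ne.
move=> f g; move: {2}(size f + size g)%N (leqnn (size f + size g)%N) => m.
elim: m f g => [|m IH] f g hm [h e].
  by left; exists 0; move: hm; rewrite leqn0 addn_eq0 size_poly_eq0 => /andP[/eqP-> _]; rewrite mul0r.
have [->|f0] := eqVneq f 0; first by left; exists 0; rewrite mul0r.
have [->|g0] := eqVneq g 0; first by right; exists 0; rewrite mul0r.
have hl : divides p (lead_coef f * lead_coef g).
  by exists (lead_coef h); rewrite -lead_coefM e lead_coefM lead_coefC.
have [f1 [ef lf]] := lcP f; have [g1 [eg lg]] := lcP g.
have {}lf := lf f0; have {}lg := lg g0.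
have [hd|hd] := pp _ _ hl.
  have hX := dvdX _ (size f).-1 hd.
  have [||h1|h1] := IH f1 g; [by lia | | |by right].
    have -> : f1 * g = f * g - g * (lead_coef f *: 'X^((size f).-1)) by rewrite [in RHS]mulrC -mulrBr [X in X - _]ef addrK mulrC.
    by apply: dividesB; [exists h | apply: divides_mull].
  by left; rewrite ef; apply: dividesD.
have hX := dvdX _ (size g).-1 hd.
have [||h1|h1] := IH f g1; [by lia | |by left|].
  have -> : f * g1 = f * g - f * (lead_coef g *: 'X^((size g).-1)) by rewrite -mulrBr [X in X - _]eg addrK.
  by apply: dividesB; [exists h | apply: divides_mull].
by right; rewrite eg; apply: dividesD.
Qed.

Section Gauss.
Variable R : idomainType.
Hypothesis ufdR : ufd R.
Implicit Types f g h : {poly R}.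

Definition primitive_poly f := forall p : R, prime_element p -> ~ divides p%:P f.

(** The primes of c divide g h one at a time, hence each divides g or h by [prime_polyC]
    and can be moved there. This replaces computations over the field of fractions. *)
Lemma cancel_content (c : R) f g h : c != 0 -> c *: f = g * h ->
  exists c1 c2 g' h', [/\ c1 != 0, c2 != 0, g = c1 *: g', h = c2 *: h' & f = g' * h'].
Proof.
move=> c0; have [s [sp [u uu ->]]] := ufdR c0; move=> {c0}.
elim: s sp g h => [|p s IH] sp g h.
  rewrite big_nil mulr1 => e; exists u, 1, (u^-1 *: g), h.
  have u0 : u != 0 by apply: contraTneq uu => ->; rewrite unitr0.
  rewrite scalerA mulrV // !scale1r oner_eq0; split=> //.
  by rewrite -scalerAl -e scalerA mulVr // scale1r.
have pp := sp p (mem_head _ _); have [p0 _ _] := pp.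
rewrite big_cons mulrCA -scalerA => e.
have [_ _ /(_ g h)[]] := prime_polyC pp.
- by exists ((u * \prod_(j <- s) j) *: f); rewrite -e -mul_polyC mulrC.
- move=> [g1 eg]; have [||c1 [c2 [g' [h' [c10 c20 e1 e2 e3]]]]] := IH _ g1 h.
  + by move=> q qs; apply: sp; rewrite inE qs orbT.
  + have P0 : p%:P != 0 by rewrite polyC_eq0.
    by apply: (mulfI P0); rewrite mul_polyC e eg; ring.
  exists (p * c1), c2, g', h'; rewrite mulf_neq0 //; split=> //.
  by rewrite eg e1 mulrC mul_polyC scalerA.
- move=> [h1 eh]; have [||c1 [c2 [g' [h' [c10 c20 e1 e2 e3]]]]] := IH _ g h1.
  + by move=> q qs; apply: sp; rewrite inE qs orbT.
  + have P0 : p%:P != 0 by rewrite polyC_eq0.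
    by apply: (mulfI P0); rewrite mul_polyC e eh; ring.
  exists c1, (p * c2), g', h'; rewrite (mulf_neq0 p0) //; split=> //.
  by rewrite eh e2 mulrC mul_polyC scalerA.
Qed.

Lemma primitive_scale (c : R) f : c != 0 -> primitive_poly (c *: f) -> c \is a GRing.unit.
Proof.
move=> c0; have [[|p s] [sp [u uu ->]]] := ufdR c0; first by rewrite big_nil mulr1.
move=> pc; case: (pc p (sp p (mem_head _ _))).
by exists ((u * \prod_(q <- s) q) *: f); rewrite big_cons -!mul_polyC !polyCM; ring.
Qed.

Lemma primitive_dvdp g f : primitive_poly g -> g %| f -> divides g f.
Proof.
move=> pg /Pdiv.Idomain.dvdpP[[c q] /= c0 e].
have [c1 [c2 [q' [g' [_ c20 e1 e2 e3]]]]] := cancel_content c0 e.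
have uc : c2 \is a GRing.unit by apply: (primitive_scale (f := g')) => //; rewrite -e2.
by exists (c2^-1 *: q'); rewrite e2 e3 -scalerAl -scalerAr scalerA mulVr // scale1r.
Qed.

(** Pseudo-division sees R[X] as if over the field of fractions, where the gcd of g and
    a is either associated with g or constant; [cancel_content] and primitivity bring
    the resulting divisibility back to R[X]. *)
Lemma irreducible_prime g : (1 < size g)%N -> primitive_poly g ->
  (forall a b, g = a * b -> (size a <= 1)%N \/ (size b <= 1)%N) -> prime_element g.
Proof.
move=> sg pg irr; have g0 : g != 0 by rewrite -size_poly_gt0 ltnW.
split=> //; first by rewrite poly_unitE gtn_eqF.
move=> a b [w e].
pose h := gcdp g a.
have /Pdiv.Idomain.dvdpP[[c q] /= c0 eq] : h %| g := dvdp_gcdl _ _.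
have [c1 [c2 [q' [h' [c10 c20 e1 e2 e3]]]]] := cancel_content c0 eq.
case: (irr _ _ e3) => hs.
  left; apply: primitive_dvdp => //.
  have -> : (g %| a) = (h %| a); last exact: dvdp_gcdr.
  apply: eqp_dvdl; rewrite eqp_sym -dvdp_size_eqp ?dvdp_gcdl //.
  have q0 : q' != 0 by apply: contraNneq g0 => q0; rewrite e3 q0 mul0r.
  have h0 : h' != 0 by apply: contraNneq g0 => h0; rewrite e3 h0 mulr0.
  have q1 : size q' = 1%N by apply/eqP; rewrite eqn_leq hs size_poly_gt0.
  by rewrite e2 size_scale // [in X in _ == X]e3 size_mul // q1.
right; apply: primitive_dvdp => //.
have cop : coprimep g a.
  have h0 : h' != 0 by apply: contraNneq g0 => h0; rewrite e3 h0 mulr0.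
  by rewrite coprimep_def -/h e2 size_scale // eqn_leq hs size_poly_gt0.
rewrite -(Gauss_dvdpr _ cop); apply/Pdiv.Idomain.dvdpP.
by exists (1, w); rewrite ?oner_eq0 // scale1r.
Qed.

Lemma factorsM (S : idomainType) (a b : S) s t : factors a s -> factors b t -> factors (a * b) (s ++ t).
Proof.
move=> [sp [u uu ->]] [tp [v vu ->]]; split.
  by move=> p; rewrite mem_cat => /orP[/sp|/tp].
by exists (u * v); rewrite ?unitrM ?uu //= big_cat /=; ring.
Qed.

Lemma primitive_factors f : f != 0 -> primitive_poly f -> exists s, factors f s.
Proof.
move: {2}(size f) (leqnn (size f)) => m; elim: m f => [|m IH] f hm f0 pf.
  by move: hm; rewrite leqn0 size_poly_eq0 (negPf f0).
have [s1|s1] := leqP (size f) 1.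
  exists [::]; split=> //; exists f; last by rewrite big_nil mulr1.
  move: (size1_polyC s1) => e; rewrite e in f0 pf *; rewrite polyC_eq0 in f0.
  rewrite poly_unitE size_polyC f0 coefC eqxx /=.
  by apply: (primitive_scale (f := 1)) => //; rewrite -mul_polyC mulr1.
have [irr|] := pselect (forall a b, f = a * b -> (size a <= 1)%N \/ (size b <= 1)%N).
  exists [:: f]; split; last by exists 1; rewrite ?unitr1 // big_seq1 mul1r.
  by move=> p; rewrite inE => /eqP ->; apply: irreducible_prime.
move=> /existsNP[a /existsNP[b /not_implyP[e /not_orP[/negP ha /negP hb]]]].
rewrite -!ltnNge in ha hb.
have a0 : a != 0 by rewrite -size_poly_gt0 ltnW.
have b0 : b != 0 by rewrite -size_poly_gt0 ltnW.
have es : size f = (size a + size b).-1 by rewrite e size_mul.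
have pa : primitive_poly a by move=> p pp h; apply: (pf p pp); rewrite e mulrC; apply: divides_mull.
have pb : primitive_poly b by move=> p pp h; apply: (pf p pp); rewrite e; apply: divides_mull.
have la : (size a <= m)%N by lia.
have lb : (size b <= m)%N by lia.
have [s fs] := IH a la a0 pa; have [t ft] := IH b lb b0 pb.
by exists (s ++ t); rewrite e; apply: factorsM.
Qed.

(** Induction on the number of prime factors of the leading coefficient: each prime
    dividing f is split off, until f is primitive and can be factored by its size. *)
Lemma poly_ufd : ufd {poly R}.
Proof.
move=> f f0; have lc0 : lead_coef f != 0 by rewrite lead_coef_eq0.
have [s] := ufdR lc0; move: {2}(size s) (erefl (size s)) => m.
elim: m f f0 {lc0} s => [|m IH] f f0 s es fs.
  apply: primitive_factors => // p pp [g e].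
  have [s' [e' _]] : exists s', size s = (size s').+1 /\ factors (lead_coef g) s'.
    by apply: (factors_div pp); rewrite -(lead_coefC p) -lead_coefM -e.
  by rewrite es in e'.
have [pf|] := pselect (primitive_poly f); first exact: primitive_factors.
move=> /existsNP[p /not_implyP[pp /contrapT[g e]]].
have [s' [e' fs']] : exists s', size s = (size s').+1 /\ factors (lead_coef g) s'.
  by apply: (factors_div pp); rewrite -(lead_coefC p) -lead_coefM -e.
have g0 : g != 0 by apply: contraNneq f0 => g0; rewrite e g0 mul0r.
have [|t ft] := IH g g0 s' _ fs'; first by move: e'; rewrite es => -[].
exists (t ++ [:: p%:P]); rewrite e; apply: factorsM => //; split.
  by move=> q; rewrite inE => /eqP ->; apply: prime_polyC.
by exists 1; rewrite ?unitr1 // big_seq1 mul1r.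
Qed.

End Gauss.

(** * Polynomials in several variables over the rationals *)

Lemma ufd_transport (R S : idomainType) (psi : {rmorphism R -> S}) (phi : {rmorphism S -> R}) :
  cancel psi phi -> cancel phi psi -> ufd S -> ufd R.
Proof.
move=> psiK phiK ufdS a a0.
have psi0 x : x != 0 -> psi x != 0.
  by apply: contra => /eqP e; rewrite -(psiK x) e rmorph0.
have dvd p x : divides (phi p) x <-> divides p (psi x).
  split=> -[c e]; first by exists (psi c); rewrite e rmorphM phiK.
  by exists (phi c); rewrite -rmorphM -e psiK.
have [s [sp [u uu e]]] := ufdS _ (psi0 a a0).
exists [seq phi p | p <- s]; split.
  move=> _ /mapP[p /sp[p0 pu pp] ->]; split.
  - by apply: contra p0 => /eqP e0; rewrite -(phiK p) e0 rmorph0.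
  - apply: contra pu => h; rewrite -(phiK p); exact: rmorph_unit.
  - by move=> x y /dvd; rewrite rmorphM => /pp[] /dvd; [left | right].
exists (phi u); first exact: rmorph_unit.
by rewrite -(psiK a) e rmorphM rmorph_prod big_map.
Qed.

Section Uni.
Variable n : nat.
Local Notation widen := (widen_ord (leqnSn n)).

Definition restr_mnm (m : 'X_{1..n.+1}) : 'X_{1..n} := [multinom m (widen i) | i < n].

Lemma muniX (m : 'X_{1..n.+1}) :
  muni ('X_[m] : {mpoly rat[n.+1]}) = 'X_[restr_mnm m] *: 'X^(m ord_max).
Proof. by rewrite muniE msuppX big_seq1 mcoeffX eqxx scale1r. Qed.

Definition unmuni (q : {poly {mpoly rat[n]}}) : {mpoly rat[n.+1]} :=
  (map_poly (@mwiden n rat) q).['X_ord_max].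

Lemma muniK : cancel (@muni n rat) unmuni.
Proof.
move=> p; rewrite [p]mpolyE; move: (msupp p) (fun m => p@_m) => s c.
rewrite raddf_sum /= /unmuni raddf_sum /= horner_sum; apply: eq_bigr => m _; rewrite muniZ muniX.
rewrite -[_ *: (_ *: _)]mul_polyC -['X_[_] *: _]mul_polyC !rmorphM /= !map_polyC /= map_polyXn.
rewrite !hornerM !hornerC hornerXn mwidenC mul_mpolyC mwidenX; congr (_ *: _).
rewrite mpolyXn -mpolyXD; congr 'X_[_]; apply/mnmP => i.
rewrite mnmDE mulmnE mnm1E; case: (unliftP ord_max i) => [j|] ->.
  have -> : lift ord_max j = widen j by apply/val_inj; rewrite /= /bump leqNgt ltn_ord.
  rewrite mnmwiden_widen mnmE [ord_max == _](_ : _ = false) ?mul0n ?addn0 //.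
  by apply/eqP => /(congr1 val) /= h; have := ltn_ord j; rewrite -h ltnn.
by rewrite mnmwiden_ordmax eqxx mul1n.
Qed.

Lemma muni_mwiden (c : {mpoly rat[n]}) : muni (mwiden c) = c%:P.
Proof.
rewrite [c]mpolyE (big_morph _ (@mwidenD n rat) (@mwiden0 n rat)).
rewrite (big_morph _ (@muniD n rat) (@muni0 n rat)) [RHS](big_morph _ (@polyCD _) (@polyC0 _)).
apply: eq_bigr => m _.
rewrite mwidenZ mwidenX muniZ muniX mnmwiden_ordmax expr0 -mul_mpolyC polyCM.
rewrite -mul_polyC; congr (_ * _); rewrite -mul_polyC mulr1; congr ('X_[_])%:P.
by apply/mnmP => i; rewrite mnmE mnmwiden_widen.
Qed.

Lemma unmuniK : cancel unmuni (@muni n rat).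
Proof.
move=> q; rewrite /unmuni horner_coef raddf_sum /=.
rewrite [RHS](_ : q = \sum_(i < size q) q`_i *: 'X^i); last by rewrite -poly_def coefK.
rewrite size_map_inj_poly ?mwiden0 //; last exact: inj_mwiden.
apply: eq_bigr => i _; rewrite coef_map /= muniM muni_mwiden -mul_polyC; congr (_ * _).
rewrite rmorphXn /= muniX mnm1E eqxx expr1.
have -> : restr_mnm U_(ord_max) = 0%MM.
  apply/mnmP => j; rewrite mnmE mnm1E mnm0E; apply/eqP; rewrite eqb0; apply/eqP => /(congr1 val) /= h.
  by have := ltn_ord j; rewrite -h ltnn.
by rewrite mpolyX0 scale1r.
Qed.

End Uni.

Lemma mpoly_rat_ufd n : ufd {mpoly rat[n]}.
Proof.
elim: n => [|n IH].
  move=> a a0; exists [::]; split=> //; exists a; last by rewrite big_nil mulr1.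
  have e := nvar0_mpolyC a; have c0 : a@_0 != 0 by apply: contraNneq a0 => c0; rewrite e c0.
  move: (a@_0) e c0 => c -> c0.
  by apply/unitrP; exists (c^-1)%:MP; rewrite -!mpolyCM mulVf ?mulfV.
pose psi : {rmorphism {mpoly rat[n.+1]} -> {poly {mpoly rat[n]}}} := @muni n rat.
pose phi : {rmorphism {poly {mpoly rat[n]}} -> {mpoly rat[n.+1]}} :=
  horner_eval ('X_ord_max : {mpoly rat[n.+1]}) \o map_poly (@mwiden n rat).
have psiK : cancel psi phi := @muniK n.
have phiK : cancel phi psi := @unmuniK n.
exact: ufd_transport psiK phiK (poly_ufd IH).
Qed.

(** One variable at a time: the leading coefficient of f in the last variable does not
    vanish at some point, and the remaining univariate polynomial has finitely many
    roots. *)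
Lemma mpoly_nonvanishing n (f : {mpoly rat[n]}) : f != 0 -> exists v, f.@[v] != 0.
Proof.
elim: n f => [|n IH] f f0.
  exists (fun _ => 0); have e := nvar0_mpolyC f; rewrite e mevalC.
  by apply: contraNneq f0 => c0; rewrite e c0.
have g0 : muni f != 0 by apply: contraNneq f0 => g0; rewrite -(muniK f) g0 /unmuni rmorph0 horner0.
have [|v hv] := IH (lead_coef (muni f)); first by rewrite lead_coef_eq0.
pose h := map_poly (meval v) (muni f).
have h0 : h != 0 by rewrite -lead_coef_eq0 lead_coef_map_eq.
pose s : seq rat := [seq i%:R | i <- iota 0 (size h)].
have /allPn/=[t ts rt] : ~~ all (root h) s.
  apply/negP => hs; have us : uniq s.
    by rewrite map_inj_uniq ?iota_uniq // => i j /eqP; rewrite Num.Theory.eqr_nat => /eqP.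
  by have := max_poly_roots h0 hs us; rewrite size_map size_iota ltnn.
pose v' (i : 'I_n.+1) := if unlift ord_max i is Some j then v j else t.
exists v'; suff -> : f.@[v'] = h.[t] by [].
rewrite /h [f]mpolyE; move: (msupp f) (fun m => f@_m) => r c.
rewrite (big_morph _ (mevalD v') (meval0 v')) (big_morph _ (@muniD n rat) (@muni0 n rat)).
rewrite rmorph_sum horner_sum.
apply: eq_bigr => m _; rewrite mevalZ muniZ muniX.
rewrite -[_ *: (_ *: _)]mul_polyC -['X_[_] *: _]mul_polyC !rmorphM /= !map_polyC /= map_polyXn.
rewrite !hornerM !hornerC hornerXn mevalC !mevalX; congr (_ * _).
rewrite big_ord_recr /= {2}/v' unlift_none; congr (_ * _); apply: eq_bigr => j _.
rewrite mnmE /v'; have -> : widen_ord (leqnSn n) j = lift ord_max j.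
  by apply/val_inj; rewrite /= /bump leqNgt ltn_ord.
by rewrite liftK.
Qed.

(** * Chains of homogeneous primes *)

(** Take a subspace inside S of the largest dimension. *)
Lemma vspace_of_pred (K : fieldType) (vT : vectType K) (S : {pred vT}) :
  0 \in S -> (forall a, {in S &, forall u v, a *: u + v \in S}) ->
  exists W : {vspace vT}, forall x, (x \in W) = (x \in S).
Proof.
move=> S0 Sl.
pose P d := `[< exists2 W : {vspace vT}, (forall x, x \in W -> x \in S) & \dim W = d >].
have P0 : exists d, P d.
  by exists 0%N; apply/asboolP; exists 0%VS; [move=> x; rewrite memv0 => /eqP -> | rewrite dimv0].
have Pb d : P d -> (d <= dim vT)%N.
  by move=> /asboolP[W _ <-]; rewrite -dimvf dimvS ?subvf.
case: (ex_maxnP P0 Pb) => d /asboolP[W WS dW] dmax; exists W => x; apply/idP/idP => [/WS //|xS].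
apply: contraT => xW; have := dmax (\dim (W + <[x]>)%VS).
rewrite -dW leqNgt ltn_neqAle dimvS ?addvSl // andbT.
have -> : (\dim W != \dim (W + <[x]>)%VS).
  rewrite (dimv_leqif_eq (addvSl W <[x]>)); apply: contra xW => /eqP ->.
  by rewrite memvE addvSr.
move=> /(_ _); apply; apply/asboolP; eexists; last reflexivity.
move=> y /memv_addP[w wW [_ /vlineP[c ->] ->]].
by rewrite addrC Sl // WS.
Qed.

Section Growth.
Variable n : nat.
Local Notation S := {mpoly rat[n.+1]}.
Local Notation Sm := (dhomog n.+1 rat).
Implicit Types I J : {pred S}.

Definition dmul D m (g : Sm D) (f : Sm m) : Sm (D + m) :=
  DHomog (dhomogM (dhomog_is_dhomog g) (dhomog_is_dhomog f)).

Lemma dmul_linear D m (g : Sm D) : linear (@dmul D m g).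
Proof. by move=> c x y; apply/val_inj => /=; rewrite mulrDr scalerAr. Qed.

HB.instance Definition _ D m (g : Sm D) :=
  GRing.isLinear.Build rat (Sm m) (Sm (D + m)) _ (@dmul D m g) (@dmul_linear D m g).

Lemma idealD I f g : idealr_closed I -> f \in I -> g \in I -> f + g \in I.
Proof. by case=> _ _ hI fI gI; have := hI 1 f g fI gI; rewrite mul1r. Qed.

Lemma idealM I f g : idealr_closed I -> g \in I -> f * g \in I.
Proof. by case=> I0 _ hI gI; have := hI f g 0 gI I0; rewrite addr0. Qed.

Lemma ideal_sum I (T : Type) (r : seq T) (F : T -> S) : idealr_closed I ->
  (forall i, F i \in I) -> \sum_(i <- r) F i \in I.
Proof.
move=> hI hF; elim: r => [|i r IH]; first by rewrite big_nil; case: hI.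
by rewrite big_cons; apply: idealD.
Qed.

Lemma graded_exists I m : idealr_closed I ->
  exists W : {vspace Sm m}, forall f, (f \in W) = ((f : S) \in I).
Proof.
move=> hI; have [||W hW] := @vspace_of_pred _ (Sm m) [pred f : Sm m | (f : S) \in I].
- by case: hI.
- move=> a u v uI vI; rewrite inE /=; apply: idealD => //.
  by rewrite -mul_mpolyC; apply: idealM.
by exists W => f; rewrite hW.
Qed.

Definition graded I m : {vspace Sm m} :=
  if pselect (idealr_closed I) is left hI then sval (cid (graded_exists m hI)) else 0%VS.

Lemma mem_graded I m f : idealr_closed I -> (f \in graded I m) = ((f : S) \in I).
Proof. by move=> hI; rewrite /graded; case: pselect => // h; apply: (svalP (cid (graded_exists m h))). Qed.

(** The Hilbert function of the quotient by I. *)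
Definition hilbert_fun I m : nat := (dim (Sm m) - \dim (graded I m))%N.

Lemma dim_graded_le I m : (\dim (graded I m) <= dim (Sm m))%N.
Proof. by rewrite -dimvf dimvS ?subvf. Qed.

Lemma dmul_ker0 D m (g : Sm D) : (g : S) != 0 -> lker (linfun (@dmul D m g)) = 0%VS.
Proof.
move=> g0; apply/eqP/lker0P => x y; rewrite !lfunE /= => /(congr1 val) /= /(mulfI g0) e.
exact: val_inj.
Qed.

Lemma dim_dmul D m (g : Sm D) (U : {vspace Sm m}) : (g : S) != 0 ->
  \dim (linfun (@dmul D m g) @: U) = \dim U.
Proof. by move=> g0; rewrite limg_dim_eq // dmul_ker0 // capv0. Qed.

(** Multiplication by g is injective modulo I, so that the multiples of g meet I exactly
    in g I. *)
Lemma dim_add_dmul I D m (g : Sm D) : idealr_closed I ->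
  (forall a, (g : S) * a \in I -> a \in I) -> (g : S) != 0 ->
  \dim (graded I (D + m) + limg (linfun (@dmul D m g)))%VS =
  (\dim (graded I (D + m)) + hilbert_fun I m)%N.
Proof.
move=> hI gI g0; have := dimv_sum_cap (graded I (D + m)) (limg (linfun (@dmul D m g))).
have -> : (graded I (D + m) :&: limg (linfun (@dmul D m g)))%VS =
    (linfun (@dmul D m g) @: graded I m)%VS.
  apply/eqP; rewrite eqEsubv; apply/andP; split; apply/subvP => x.
    rewrite memv_cap => /andP[+ /memv_imgP[a _ e]]; rewrite e lfunE mem_graded //= => /gI aI.
    by rewrite -lfunE memv_img // mem_graded.
  move=> /memv_imgP[a aI ->]; rewrite memv_cap memv_img ?memvf // andbT lfunE mem_graded //=.
  by apply: idealM => //; rewrite -mem_graded.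
rewrite !dim_dmul // dimvf /hilbert_fun => e; apply/eqP.
by rewrite -(eqn_add2r (\dim (graded I m))) e -addnA subnK // dim_graded_le.
Qed.

(** Modulo I, the ideal J contains a copy of the quotient by I, shifted by the degree of
    g. *)
Lemma hilbert_fun_drop I J D m (g : Sm D) : idealr_closed I -> idealr_closed J ->
  {subset I <= J} -> (g : S) \in J ->
  (forall a, (g : S) * a \in I -> a \in I) -> (g : S) != 0 ->
  (hilbert_fun J (D + m) + hilbert_fun I m <= hilbert_fun I (D + m))%N.
Proof.
move=> hI hJ IJ gJ gI g0.
have : (graded I (D + m) + limg (linfun (@dmul D m g)) <= graded J (D + m))%VS.
  rewrite subv_add; apply/andP; split; apply/subvP => x; first by rewrite !mem_graded //; exact: IJ.
  move=> /memv_imgP[a _ ->]; rewrite lfunE mem_graded //= mulrC; exact: idealM.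
move=> /dimvS; rewrite dim_add_dmul // /hilbert_fun.
have := dim_graded_le I m; have := dim_graded_le J (D + m); have := dim_graded_le I (D + m); lia.
Qed.

Lemma hilbert_fun_mono I D m (g : Sm D) : idealr_closed I ->
  (forall a, (g : S) * a \in I -> a \in I) -> (g : S) != 0 ->
  (hilbert_fun I m <= hilbert_fun I (D + m))%N.
Proof.
move=> hI gI g0; have := dim_add_dmul m hI gI g0.
have : (\dim (graded I (D + m) + limg (linfun (@dmul D m g)))%VS <= dim (Sm (D + m)))%N.
  by rewrite -dimvf dimvS ?subvf.
rewrite /hilbert_fun; have := dim_graded_le I m; have := dim_graded_le I (D + m); lia.
Qed.

Lemma prime_regular I (g : S) : prime_idealr_closed I -> g \notin I ->
  forall a, g * a \in I -> a \in I.
Proof. by move=> pI gI a /pI; rewrite (negPf gI). Qed.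

Lemma notin_neq0 I (g : S) : idealr_closed I -> g \notin I -> g != 0.
Proof. by case=> I0 _ _; apply: contraNneq => ->. Qed.

Lemma proj_prime_mono I m e : proj_prime I -> (hilbert_fun I m <= hilbert_fun I (m + e))%N.
Proof.
case=> [[hI _] pI [i Xi]]; elim: e => [|e IH]; first by rewrite addn0.
apply: leq_trans IH _; rewrite addnS -add1n.
have X1 : ('X_i : S) \is 1.-homog by rewrite dhomogX /= mdeg1.
exact: (@hilbert_fun_mono I 1 (m + e) (DHomog X1) hI (prime_regular pI Xi) (notin_neq0 hI Xi)).
Qed.

Lemma proj_prime_hilbert_fun_gt0 I m : proj_prime I -> (0 < hilbert_fun I m)%N.
Proof.
case=> [[hI _] pI [i Xi]]; rewrite /hilbert_fun subn_gt0 ltn_neqAle dim_graded_le andbT -dimvf.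
apply/eqP => e.
have full : graded I m = fullv by apply/eqP; rewrite -(dimv_leqif_eq (subvf _)) e.
have Xm : ('X_i ^+ m : S) \is m.-homog by rewrite -[m in m.-homog]mul1n; apply: dhomogMn; rewrite dhomogX /= mdeg1.
have : ('X_i ^+ m : S) \in I by rewrite -(mem_graded (DHomog Xm) hI) full memvf.
elim: (m) => [|k IH]; first by rewrite expr0; case: hI => _ /negPf ->.
by rewrite exprS => /pI; rewrite (negPf Xi).
Qed.

Lemma homogeneous_difference I J f : homog_ideal I -> homog_ideal J -> f \in J -> f \notin I ->
  exists d, (pihomog mdeg d f \in J) && (pihomog mdeg d f \notin I).
Proof.
move=> [hI _] [_ gJ] fJ; apply: contraNP => h.
rewrite (pihomog_partitionE (leqnn (msize f))); apply: ideal_sum => // d.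
by apply: contrapT => /negP hd; apply: h; exists d; rewrite gJ.
Qed.

Definition growth I r := exists K, forall m, (hilbert_fun I m <= K * m.+1 ^ r)%N.

Lemma growth_all I : growth I n.
Proof.
exists 1%N => m; rewrite mul1n; apply: leq_trans (leq_subr _ _) _.
have bs a b : 'C(a + b, a) = 'C(a + b, b) by rewrite -(bin_sub (leq_addl a b)) addnK.
rewrite /dim /=; elim: (n) => [|k IH]; first by rewrite bs bin0.
rewrite -(leq_pmul2l (ltn0Sn k)) bs addnS -mul_bin_diag [(_ + _).+1.-1]/= -bs.
have h : ((m + k).+1 <= k.+1 * m.+1)%N by nia.
by apply: leq_trans (leq_mul h IH) _; rewrite expnS mulnA.
Qed.

Lemma growth_drop_aux I J : proj_prime I -> proj_prime J -> {subset I <= J} -> ~ {subset J <= I} ->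
  exists D, forall m s, (s * hilbert_fun J m <= hilbert_fun I (m + s * D))%N.
Proof.
move=> pI pJ IJ /existsNP[f /not_implyP[fJ /negP fI]].
have [hI qI _] := pI; have [hJ _ _] := pJ.
have [D /andP[gJ gI]] := homogeneous_difference hI hJ fJ fI.
pose g : Sm D := DHomog (pihomogP mdeg D f).
exists D => m; elim=> [|s IH]; first by rewrite mul0n.
have := @hilbert_fun_drop I J D (m + s * D) g hI.1 hJ.1 IJ gJ (prime_regular qI gI) (notin_neq0 hI.1 gI).
have := proj_prime_mono m (D + s * D) pJ.
rewrite !mulSn; have -> : (D + (m + s * D) = m + (D + s * D))%N by lia.
lia.
Qed.

(** Summing [hilbert_fun_drop] along m, m + D, m + 2 D, and so on bounds about m copies
    of the Hilbert function of J by one value of that of I, which costs one power of m.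
    *)
Lemma growth_drop I J r : proj_prime I -> proj_prime J -> {subset I <= J} -> ~ {subset J <= I} ->
  growth I r.+1 -> growth J r.
Proof.
move=> pI pJ IJ JI [K hK]; have [D hD] := growth_drop_aux pI pJ IJ JI.
exists (K * D.+1 ^ r.+1)%N => m; rewrite -(leq_pmul2l (ltn0Sn m)).
apply: leq_trans (hD m m.+1) _; apply: leq_trans (hK _) _.
have -> : (m + m.+1 * D).+1 = (m.+1 * D.+1)%N by lia.
by rewrite expnMn (expnS m.+1); apply: eq_leq; ring.
Qed.

Lemma growth0_maximal I J : proj_prime I -> proj_prime J -> {subset I <= J} -> growth I 0 ->
  {subset J <= I}.
Proof.
move=> pI pJ IJ [K hK]; apply: contrapT => JI; have [D hD] := growth_drop_aux pI pJ IJ JI.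
have := leq_trans (hD 0%N K.+1) (hK _); rewrite expn0 muln1.
have := proj_prime_hilbert_fun_gt0 0 pJ; nia.
Qed.

Lemma prime_chain_le (P : {pred S}) r : prime_chain P r -> (r <= n)%N.
Proof.
move=> [Q [_ pQ sQ]].
suff h i : (i <= r)%N -> (i <= n)%N /\ growth (Q i) (n - i) by have [] := h r (leqnn r).
elim: i => [|i IH] ir; first by rewrite subn0; split=> //; exact: growth_all.
have [ilen gi] := IH (ltnW ir); have [s1 s2] := sQ i ir.
have pi := pQ i (ltnW ir); have pi1 := pQ i.+1 ir.
have [ei|ine] := eqVneq i n.
  by move: gi; rewrite ei subnn -ei => gi; case: s2; exact: (growth0_maximal pi pi1).
have iltn : (i < n)%N by rewrite ltn_neqAle ine.
by split=> //; apply: (growth_drop pi pi1) => //; rewrite subnSK.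
Qed.
End Growth.

(** * Codimension one primes are principal *)

Lemma mpolyX_eq0 n (m : 'X_{1..n}) : ('X_[m] == 0 :> {mpoly rat[n]}) = false.
Proof. by rewrite -msize_poly_eq0 msizeX. Qed.

Lemma pihomog_sum n d (I : Type) (r : seq I) (P : pred I) (F : I -> {mpoly rat[n]}) :
  pihomog mdeg d (\sum_(i <- r | P i) F i) = \sum_(i <- r | P i) pihomog mdeg d (F i).
Proof. by rewrite (big_morph _ (@pihomogD _ _ _ d) (@pihomog0 _ _ _ d)). Qed.

Section Substitution.
Variables (n k : nat) (lq : n.+1.-tuple {mpoly rat[k]}).
Hypothesis lin : forall i, tnth lq i \is 1.-homog.

Lemma comp_dhomog f d : f \is d.-homog -> (f \mPo lq) \is d.-homog.
Proof.
move=> /dhomogP hf; rewrite comp_mpolyEX; rewrite big_seq; apply: rpred_sum => m mf.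
rewrite rpredZ // comp_mpolyX -(hf m mf) /= mdegE.
elim/big_ind2: _ => [|p a q b hp hq|i _]; first exact: dhomog1.
  exact: dhomogM.
by have := dhomogMn (m i) (lin i); rewrite mul1n.
Qed.

Lemma pihomog_comp f d : pihomog mdeg d (f \mPo lq) = pihomog mdeg d f \mPo lq.
Proof.
rewrite [in LHS](pihomog_partitionE (leq_maxl (msize f) d.+1)).
rewrite (big_morph _ (comp_mpolyD lq) (comp_mpoly0 lq)) pihomog_sum.
have dN : (d < maxn (msize f) d.+1)%N by rewrite leq_max ltnSn orbT.
rewrite (bigD1 (Ordinal dN)) //= big1 ?addr0 => [|i ne].
  by apply/pihomog_dE/comp_dhomog/pihomogP.
by apply: (pihomog_ne0 _ (comp_dhomog (pihomogP mdeg i f))); apply: contra ne => /eqP e; apply/eqP/val_inj.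
Qed.

Definition subst_ker : {pred {mpoly rat[n.+1]}} := [pred f | f \mPo lq == 0].

(** Kernels of linear substitutions supply all the explicit primes that are needed: the
    coordinate subspaces and the rational points. *)
Lemma subst_ker_prime i : tnth lq i != 0 -> proj_prime subst_ker.
Proof.
move=> li; split.
- split; first split.
  + by rewrite inE comp_mpoly0.
  + by rewrite inE comp_mpoly1 oner_eq0.
  + by move=> a u v; rewrite !inE => /eqP hu /eqP hv; rewrite comp_mpolyD rmorphM /= hu hv mulr0 addr0.
  by move=> f d; rewrite !inE -pihomog_comp => /eqP ->; rewrite pihomog0.
- by move=> u v; rewrite !inE rmorphM mulf_eq0.
- by exists i; rewrite inE comp_mpolyXU -tnth_nth.
Qed.

End Substitution.

(** The ideals (X_0, .., X_(i-1)), each obtained as the kernel of the substitution of 0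
    for its variables. *)
Lemma coordinate_chain n : @prime_chain n [pred f | f == 0] n.
Proof.
pose lq i := [tuple if (j < i)%N then 0 else 'X_j | j < n.+1] : n.+1.-tuple {mpoly rat[n.+1]}.
have lin i j : tnth (lq i) j \is 1.-homog.
  by rewrite tnth_mktuple; case: ifP => _; [exact: dhomog0 | rewrite dhomogX /= mdeg1].
have memX i j : ('X_j \in subst_ker (lq i)) = (j < i)%N.
  rewrite inE comp_mpolyXU -tnth_nth tnth_mktuple; case: ifP; first by rewrite eqxx.
  by rewrite mpolyX_eq0.
have nX i : (i <= n)%N -> proj_prime (subst_ker (lq i)).
  move=> ilen; apply: (subst_ker_prime (lin i) (i := ord_max)).
  by rewrite tnth_mktuple ltnNge ilen mpolyX_eq0.
exists (fun i => subst_ker (lq i)); split.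
- move=> f; rewrite !inE; have -> : lq 0%N = [tuple 'X_j | j < n.+1].
    by apply: eq_from_tnth => j; rewrite !tnth_mktuple.
  by rewrite comp_mpoly_id.
- exact: nX.
- move=> i ilen; split.
    move=> f; rewrite !inE => /eqP h.
    have -> : f \mPo lq i.+1 = (f \mPo lq i) \mPo lq i.+1; last by rewrite h comp_mpoly0.
    rewrite [f \mPo lq i]comp_mpolyEX (big_morph _ (comp_mpolyD _) (comp_mpoly0 _)).
    rewrite [LHS]comp_mpolyEX; apply: eq_bigr => m _; rewrite comp_mpolyZ; congr (_ *: _).
    rewrite !comp_mpolyX rmorph_prod; apply: eq_bigr => j _; rewrite rmorphXn /=; congr (_ ^+ _).
    rewrite !tnth_mktuple; case: (ltnP j i) => h1; first by rewrite ltnS (ltnW h1) comp_mpoly0.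
    by rewrite comp_mpolyXU -tnth_nth tnth_mktuple.
  have jlt : (i < n.+1)%N by rewrite ltnS ltnW.
  by move=> /(_ 'X_(Ordinal jlt)); rewrite !memX /= ltnSn ltnn => /(_ isT).
Qed.

Lemma prime_chain_eqi n (P Q : {pred {mpoly rat[n.+1]}}) r : P =i Q -> prime_chain P r -> prime_chain Q r.
Proof. by move=> e [F [F0 h1 h2]]; exists F; split=> // f; rewrite F0 e. Qed.

Lemma irr_dim_neq0 n (P : {pred {mpoly rat[n.+1]}}) r :
  proj_prime P -> irr_dim P r -> (r < n)%N -> exists2 f, f \in P & f != 0.
Proof.
move=> pP [_ hmax] rn; apply: contrapT => h; suff /hmax : prime_chain P n by lia.
apply: prime_chain_eqi (coordinate_chain n) => f; rewrite inE; apply/idP/idP => [/eqP ->|fP].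
  by case: pP => [[[]]].
by apply: contrapT => /negP f0; apply: h; exists f.
Qed.

Section PihomogM.
Variables (n D : nat) (p : {mpoly rat[n]}).
Hypothesis hp : p \is D.-homog.

Lemma pihomogM c d : pihomog mdeg d (c * p) = if (D <= d)%N then pihomog mdeg (d - D) c * p else 0.
Proof.
rewrite [in LHS](pihomog_partitionE (leq_maxl (msize c) d.+1)) mulr_suml pihomog_sum.
have dN : (d - D < maxn (msize c) d.+1)%N by rewrite leq_max ltnS leq_subr orbT.
have hc e : pihomog mdeg e c * p \is (e + D).-homog by apply: dhomogM => //; exact: pihomogP.
case: leqP => [Dd|dD].
  rewrite (bigD1 (Ordinal dN)) //= big1 ?addr0 => [|i ne].
    by apply/pihomog_dE; rewrite -{2}(subnK Dd).
  apply: (pihomog_ne0 _ (hc i)); apply: contra ne => /eqP e; apply/eqP/val_inj => /=; lia.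
rewrite big1 // => i _; apply: (pihomog_ne0 _ (hc i)); lia.
Qed.
End PihomogM.

Lemma msize_dhomog n (p : {mpoly rat[n]}) d : p != 0 -> p \is d.-homog -> msize p = d.+1.
Proof.
move=> p0 hp; rewrite -(dhomog_uniq p0 (dhomog_msize hp) hp) prednK //.
by rewrite lt0n msize_poly_eq0.
Qed.

(** A nonzero element of P of least degree has a prime factor p in P, and p is
    homogeneous because its components lie in P and have no smaller degree. If (p) were
    smaller than P, a maximal chain above P, preceded by 0 and (p), would be longer than
    [prime_chain_le] allows. *)
Lemma hypersurface_principal n (P : {pred {mpoly rat[n.+2]}}) :
  proj_prime P -> irr_dim P n -> exists D p,
    [/\ p \is D.-homog, p != 0 & forall f, f \in P <-> divides p f].
Proof.
move=> pP dimP; have [hP qP XP] := pP; have [iP gP] := hP; have [P0 P1 _] := iP.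
have [f fP f0] := irr_dim_neq0 pP dimP (ltnSn n).
pose good m := `[< exists f : {mpoly rat[n.+2]}, [/\ f \in P, f != 0 & msize f = m] >].
have exg : exists m, good m by exists (msize f); apply/asboolP; exists f.
case: (ex_minnP exg) => M /asboolP[f1 [f1P f10 f1M]] Mmin.
have [s [sp [u uu e1]]] := mpoly_rat_ufd f10.
have uP : u \notin P.
  by apply: contra P1 => uP; rewrite -(mulVr uu); exact: idealM.
have [p ps pP'] : exists2 p, p \in s & p \in P.
  move: f1P; rewrite e1 => /qP; rewrite (negPf uP) /=.
  elim: s {sp e1} => [|q s IH]; first by rewrite big_nil (negPf P1).
  rewrite big_cons => /qP/orP[qP'|/IH[p ps pP']]; first by exists q => //; rewrite mem_head.
  by exists p => //; rewrite inE ps orbT.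
have [p0 pu pp] := sp p ps.
have Mp : (msize p <= M)%N.
  have h : f1 = (u * \prod_(q <- rem p s) q) * p by rewrite e1 (big_rem p) //=; ring.
  move: (u * _) h => g h; have g0 : g != 0 by apply: contraNneq f10 => g0; rewrite h g0 mul0r.
  have : (0 < msize g)%N by rewrite lt0n msize_poly_eq0.
  by rewrite -f1M h msizeM //; move: (msize g) (msize p); clear; lia.
have szP g : g \in P -> g != 0 -> (M <= msize g)%N by move=> gP' g0; apply: Mmin; apply/asboolP; exists g.
pose D := (msize p).-1.
have homp : p \is D.-homog.
  have hd d : d != D -> pihomog mdeg d p = 0.
    move=> dD; apply/eqP; apply: contraNT dD => pd0.
    have := szP _ (gP p d pP') pd0.
    rewrite (msize_dhomog pd0 (pihomogP mdeg d p)) => h1.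
    have : (d < msize p)%N.
      rewrite ltnNge; apply: contra pd0 => hge.
      rewrite pihomogE big_seq_cond big1 // => m /andP[mp /eqP md].
      by have := msize_mdeg_lt mp; rewrite [mdeg m]md ltnNge hge.
    move=> h2; rewrite /D; move: (msize p) Mp h1 h2 => q; clear; lia.
  rewrite (pihomog_partitionE (leqnn (msize p))); apply: rpred_sum => d _.
  by have [->|/hd ->] := eqVneq (d : nat) D; [exact: pihomogP | exact: dhomog0].
exists D, p; split=> // g; split=> [gP'|[c ->]]; last exact: idealM.
pose I : {pred {mpoly rat[n.+2]}} := [pred g | `[< divides p g >]].
have IP : {subset I <= P} by move=> x /asboolP[c ->]; exact: idealM.
have pI : proj_prime I.
  split.
  - split; first split.
    + by apply/asboolP; exists 0; rewrite mul0r.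
    + by apply: contra P1; exact: IP.
    + by move=> a x y /asboolP hx /asboolP hy; apply/asboolP/dividesD => //; exact: divides_mull.
    move=> x d /asboolP[c ->]; apply/asboolP; rewrite (pihomogM homp).
    by case: ifP => _; [exists (pihomog mdeg (d - D) c) | exists 0; rewrite mul0r].
  - by move=> x y /asboolP /pp[] h; apply/orP; [left|right]; apply/asboolP.
  - by have [i hi] := XP; exists i; apply: contra hi; exact: IP.
apply: contrapT => ng.
have [[Q [Q0 pQ sQ]] _] := dimP.
pose Z : {pred {mpoly rat[n.+2]}} := [pred f | f == 0].
have pZ : proj_prime Z.
  split; first split; first split.
  - by rewrite inE.
  - by rewrite inE oner_eq0.
  - by move=> a u' v; rewrite !inE => /eqP -> /eqP ->; rewrite mulr0 addr0.
  - by move=> g' d; rewrite !inE => /eqP ->; rewrite pihomog0.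
  - by move=> u' v; rewrite !inE mulf_eq0.
  - by exists ord0; rewrite inE mpolyX_eq0.
(* The chain 0 < (p) < P < ... *)
pose Q' i := if i is i'.+1 then if i' is i''.+1 then Q i'' else I else Z.
suff : prime_chain Z n.+2 by move/prime_chain_le; rewrite ltnn.
exists Q'; split=> //.
  by case=> [|[|i]] //= hi; apply: pQ.
case=> [|[|i]] /= hi.
- split; first by move=> x /eqP ->; case: pI => [[[]]].
  by move=> /(_ p) h; case/negP: p0; apply: h; apply/asboolP; exists 1; rewrite mul1r.
- split; first by move=> x /IP; rewrite Q0.
  by move=> /(_ g) h; apply: ng; apply/asboolP; apply: h; rewrite Q0.
- by apply: sQ.
Qed.

Lemma principal_degree_gt0 n (P : {pred {mpoly rat[n.+1]}}) D p : proj_prime P ->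
  p \is D.-homog -> p != 0 -> p \in P -> (0 < D)%N.
Proof.
move=> [[hI _] _ _] hp p0 pP; have [_ P1 _] := hI; rewrite lt0n; apply: contra P1 => /eqP D0.
have sp : msize p = 1%N by rewrite (msize_dhomog p0 hp) D0.
have /msize_poly1P[c c0 e] : msize p == 1%N by rewrite sp.
have -> : 1 = c^-1%:MP * p by rewrite e -mpolyCM mulVf.
exact: idealM.
Qed.

(** The part of P of degree D + m consists of the multiples of p by forms of degree m.
    *)
Lemma principal_hilbert n (P : {pred {mpoly rat[n.+1]}}) D p m h : idealr_closed P ->
  p \is D.-homog -> p != 0 -> (forall f, f \in P <-> divides p f) ->
  hilbert_value P (D + m) h -> h = ('C(D + m + n, D + m) - 'C(m + n, m))%N.
Proof.
move=> hI hp p0 hP [W hW ->]; rewrite dimvf; congr (_ - _)%N.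
pose g : dhomog n.+1 rat D := DHomog hp.
have -> : W = limg (linfun (@dmul n D m g)).
  apply/vspaceP => f; rewrite hW; apply/idP/idP => [/hP[c e]|/memv_imgP[a _ ->]]; last first.
    by rewrite lfunE /=; apply/hP; exists (a : {mpoly rat[n.+1]}); rewrite mulrC.
  have e' : (f : {mpoly rat[n.+1]}) = pihomog mdeg m c * p.
    have := pihomogM hp c (D + m); rewrite leq_addr -e pihomog_dE; last exact: dhomog_is_dhomog.
    by rewrite addKn.
  have -> : f = linfun (@dmul n D m g) (DHomog (pihomogP mdeg m c)).
    by apply/val_inj; rewrite lfunE /= e' mulrC.
  by rewrite memv_img // memvf.
by rewrite dim_dmul // dimvf.
Qed.

(** The Hilbert polynomial is C(X + 4, 4) - C(X - D + 4, 4), with leading term D X^3 /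
    6. *)
Lemma hypersurface_degree (P : {pred {mpoly rat[5]}}) D p e : proj_prime P -> irr_dim P 3 ->
  p \is D.-homog -> p != 0 -> (forall f, f \in P <-> divides p f) ->
  irr_degree P e -> e = D.
Proof.
move=> pP dimP hp p0 hP [r [H [dimr [m0 hH] eH]]].
have [[hI _] _ _] := pP.
have r3 : r = 3%N.
  apply/eqP; rewrite eqn_leq; have [c1 h1] := dimP; have [c2 h2] := dimr.
  by rewrite (h1 _ c2) (h2 _ c1).
have D0 : (0 < D)%N.
  apply: (principal_degree_gt0 pP hp p0); apply/hP; exists 1; by rewrite mul1r.
have bin4 m : ('C(m + 4, m))%:R * 24 = (m%:R + 1) * (m%:R + 2) * (m%:R + 3) * (m%:R + 4) :> rat.
  have -> : 'C(m + 4, m) = 'C(m + 4, 4) by rewrite -(bin_sub (leq_addl m 4)) addnK.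
  have e4 : ('C(m + 4, 4) * 24 = (m + 1) * (m + 2) * (m + 3) * (m + 4))%N.
    rewrite -[24%N]/(4`!) bin_ffact [(m + 4)%N](_ : _ = m.+4); last by lia.
    by rewrite !ffactnS ffactn0 !succnK; lia.
  by have := congr1 (fun x : nat => x%:R : rat) e4; rewrite !natrM !natrD.
pose a : rat := D%:R.
(* 24 times the Hilbert polynomial: q(X) - q(X - a) for q = (X + 1) (X + 2) (X + 3) (X + 4). *)
pose G : {poly rat} := Poly [:: - (a ^+ 4) + 10 * a ^+ 3 - 35 * a ^+ 2 + 50 * a;
   4 * a ^+ 3 - 30 * a ^+ 2 + 70 * a; - 6 * a ^+ 2 + 30 * a; 4 * a].
have HG : 24%:P * H = G.
  pose s : seq rat := [seq (D + m0 + i)%:R | i <- iota 0 (size (24%:P * H - G))].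
  apply/eqP; rewrite -subr_eq0; apply: contraT => ne0.
  have us : uniq s by rewrite map_inj_uniq ?iota_uniq // => i j /eqP; rewrite eqr_nat eqn_add2l => /eqP.
  have rs : all (root (24%:P * H - G)) s.
    apply/allP => _ /mapP[i _ ->]; rewrite /root hornerD hornerN hornerM hornerC.
    have [|h hv ->] := hH (D + m0 + i)%N; first by rewrite -addnA addnCA leq_addr.
    rewrite -addnA in hv *; have eh := principal_hilbert hI hp p0 hP hv.
    have le : ('C(m0 + i + 4, m0 + i) <= 'C(D + (m0 + i) + 4, D + (m0 + i)))%N.
      have bs m : 'C(m + 4, m) = 'C(m + 4, 4) by rewrite -(bin_sub (leq_addl m 4)) addnK.
      by rewrite !bs leq_bin2l // leq_add2r leq_addl.
    rewrite eh natrB // mulrBr ![24 * _]mulrC !bin4 /G horner_Poly /= natrD -/a.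
    by apply/eqP; ring.
  by have := max_poly_roots ne0 rs us; rewrite size_map size_iota ltnn.
have a0 : a != 0 by rewrite pnatr_eq0 -lt0n.
have lcG : lead_coef G = 4 * a.
  by rewrite /G lead_coefE (@PolyK _ 0) //= mulf_neq0.
have : 24 * lead_coef H = 4 * a by rewrite -lcG -HG lead_coefM lead_coefC.
move=> e24; apply/eqP; rewrite -(eqr_nat rat) eH r3 -/a; apply/eqP.
by rewrite [3`!%:R](_ : _ = 6) //; move: e24; set l := lead_coef H => e24; lra.
Qed.

(** * Primitive integer bases and their minors *)

Notation "A ^Q" := (map_mx (intr : int -> rat) A) (at level 2, format "A ^Q").

Lemma mapQM m n p (A : 'M[int]_(m, n)) (B : 'M[int]_(n, p)) : (A *m B)^Q = A^Q *m B^Q.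
Proof. exact: map_mxM. Qed.

(** The rows form a basis of the integral points of the subspace that they span. *)
Definition primitive_rows k n (B : 'M[int]_(k, n)) := exists C : 'M[int]_(n, k), B *m C = 1%:M.

Lemma mapQ_inj m n : injective (fun A : 'M[int]_(m, n) => A^Q).
Proof.
move=> A B /matrixP eAB; apply/matrixP=> i j.
by have := eAB i j; rewrite !mxE => /intr_inj.
Qed.

Lemma primitive_rows_free k n (B : 'M[int]_(k, n)) : primitive_rows B -> row_free B^Q.
Proof. by case=> C BC; apply/row_freeP; exists C^Q; rewrite -mapQM BC map_mx1. Qed.

Lemma primitive_rows_factor k l n (B : 'M[int]_(k, n)) (B' : 'M[int]_(l, n)) :
  primitive_rows B -> (B'^Q <= B^Q)%MS -> exists X, B' = X *m B.
Proof.
case=> C BC /submxP[Y eY]; exists (B' *m C); apply: mapQ_inj.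
by rewrite !mapQM eY -(mulmxA Y) -mapQM BC map_mx1 mulmx1.
Qed.

Lemma clear_denominators m n (M : 'M[rat]_(m, n)) :
  exists2 c : int, c != 0 & exists N : 'M[int]_(m, n), N^Q = c%:~R *: M.
Proof.
pose c := \prod_i \prod_j denq (M i j).
exists c; first by apply/prodf_neq0 => i _; apply/prodf_neq0 => j _; exact: denq_neq0.
exists (\matrix_(i, j) numq (c%:~R * M i j)); apply/matrixP=> i j.
rewrite !mxE numqK // /c (bigD1 i) //= (bigD1 j) //= !rmorphM /=.
set b := (_%:~R : rat); set e := (_%:~R : rat); set g := (_%:~R : rat).
have -> : b * e * g * M i j = (numq (M i j))%:~R * e * g by rewrite numqE /b; ring.
by rewrite !rpredM // intr_int.
Qed.

(** Smith normal form: the rows of an integral matrix of rank k span the same rational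
    space as k rows of a unimodular matrix. *)
Lemma primitive_rows_basis p n (V : 'M[rat]_(p, n)) :
  exists2 B : 'M[int]_(\rank V, n), primitive_rows B & (B^Q :=: V)%MS.
Proof.
have [c c0 [N eN]] := clear_denominators (row_base V).
set k := \rank V in N eN *.
have le_kn : (k <= n)%N := rank_leq_col V.
have Nfree : row_free N^Q by rewrite eN /row_free (eqmx_scale _ _) ?intr_eq0 //; exact: row_base_free.
have [L uL [R uR [d _ eNLR]]] := int_Smith_normal_form N.
pose D : 'M[int]_k := diag_mx (\row_i d`_i).
have eD : (\matrix_(i, j) (d`_i *+ (i == j :> nat)) : 'M[int]_(k, n)) = D *m pid_mx k.
  apply/matrixP=> i j; by rewrite mul_diag_mx !mxE ltn_ord andbT mulr_natr.
rewrite eD in eNLR.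
exists (pid_mx k *m R).
  exists (invmx R *m pid_mx k); rewrite mulmxA mulmxK // mul_pid_mx minnn.
  by rewrite (minn_idPr le_kn) pid_mx_1.
have sub : (N^Q <= ((pid_mx k : 'M_(k, n)) *m R)^Q)%MS.
  by rewrite eNLR -!mulmxA mulmxA mapQM submxMl.
have eNV : (N^Q :=: V)%MS.
  by rewrite eN; apply: eqmx_trans (eq_row_base V); apply: eqmx_scale; rewrite intr_eq0.
suff h : (N^Q :=: ((pid_mx k : 'M_(k, n)) *m R)^Q)%MS by exact: (eqmx_trans (eqmx_sym h) eNV).
apply/eqmxP; rewrite -mxrank_leqif_eq // eqn_leq mxrankS //=.
by rewrite (eqP Nfree) rank_leq_row.
Qed.

(** Smith normal form again: the invariant factors of a primitive matrix are units. *)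
Lemma primitive_rows_complete k m (X : 'M[int]_(k, k + m)) :
  primitive_rows X -> exists Y : 'M[int]_(m, k + m), col_mx X Y \in unitmx.
Proof.
case=> C XC; have [L uL [R uR [d _ eX]]] := int_Smith_normal_form X.
pose D : 'M[int]_k := diag_mx (\row_i d`_i).
have eD : (\matrix_(i, j) (d`_i *+ (i == j :> nat)) : 'M[int]_(k, k + m)) = row_mx D 0.
  apply/matrixP=> i j; rewrite !mxE; case: splitP => j' ej'; rewrite !mxE ej'.
    by [].
  by have /ltn_eqF -> : (i < k + j')%N by apply: leq_trans (ltn_ord i) (leq_addr _ _).
have uD : L *m D \in unitmx.
  have : (L *m D) *m usubmx (R *m C) = 1%:M.
    rewrite -XC {1}eX eD -!mulmxA; congr (_ *m _).
    by rewrite -{2}(vsubmxK (R *m C)) mul_row_col mul0mx addr0.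
  by case/mulmx1_unit.
exists (row_mx 0 1%:M *m R).
have -> : col_mx X (row_mx 0 1%:M *m R) = block_mx (L *m D) 0 0 1%:M *m R.
  rewrite {1}eX eD -mul_col_mx mul_mx_row mulmx0; congr (_ *m _).
by rewrite unitmx_mul uR andbT unitmxE det_ublock det1 mulr1 -unitmxE.
Qed.

(** The Plücker coordinates are the maximal minors; allowing all maps f, and not only
    increasing ones, adds only repetitions up to sign and zeros. *)
Definition maxminor k n (B : 'M[int]_(k, n)) : nat :=
  \max_(f : {ffun 'I_k -> 'I_n}) `|\det (colsub f B)|%N.

Lemma minor_le k n (B : 'M[int]_(k, n)) (f : 'I_k -> 'I_n) :
  (`|\det (colsub f B)| <= maxminor B)%N.
Proof.
have -> : colsub f B = colsub [ffun i => f i] B by apply: eq_colsub => i; rewrite ffunE.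
exact: (leq_bigmax [ffun i => f i]).
Qed.

Lemma maxminor_attained k n (B : 'M[int]_(k, n)) :
  (0 < maxminor B)%N -> exists f : 'I_k -> 'I_n, `|\det (colsub f B)|%N = maxminor B.
Proof.
rewrite /maxminor; case: (posnP #|{ffun 'I_k -> 'I_n}|) => [T0|/bigop.eq_bigmax h].
  by rewrite big_pred0 // => f; have := fintype0 f; rewrite T0.
by have [f ->] := h (fun f : {ffun 'I_k -> 'I_n} => `|\det (colsub f B)|%N); exists f.
Qed.

Lemma maxminorM k n (X : 'M[int]_k) (B : 'M[int]_(k, n)) :
  maxminor (X *m B) = (`|\det X| * maxminor B)%N.
Proof.
rewrite /maxminor big_distrr /=; apply: eq_bigr => f _.
by rewrite -mulmx_colsub det_mulmx abszM.
Qed.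

Lemma maxminor_gt0 k n (B : 'M[int]_(k, n)) : row_free B^Q -> (0 < maxminor B)%N.
Proof.
move=> fB.
have full : row_full (B^Q)^T by rewrite /row_full mxrank_tr.
have := fullrowsub_unit full; rewrite -trmx_mxsub unitmx_tr unitmxE => h.
have := minor_le B (fullrankfun full); apply: leq_trans.
rewrite absz_gt0; apply: contraTneq h => e.
by rewrite -[mxsub _ _ _]map_mxsub det_map_mx e rmorph0 unitr0.
Qed.

(** * Heights of rational subspaces and duality *)

Definition intbasis n (V : 'M[rat]_n) : 'M[int]_(\rank V, n) := s2val (cid2 (primitive_rows_basis V)).

Definition height n (V : 'M[rat]_n) : nat := maxminor (intbasis V).

Lemma intbasis_primitive n (V : 'M[rat]_n) : primitive_rows (intbasis V).
Proof. exact: (s2valP (cid2 (primitive_rows_basis V))). Qed.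

Lemma intbasisE n (V : 'M[rat]_n) : ((intbasis V)^Q :=: V)%MS.
Proof. exact: (s2valP' (cid2 (primitive_rows_basis V))). Qed.

Lemma heightE k n (B : 'M[int]_(k, n)) (V : 'M[rat]_n) :
  primitive_rows B -> (B^Q :=: V)%MS -> height V = maxminor B.
Proof.
move=> pB eB.
have ek : k = \rank V by rewrite -eB (eqP (primitive_rows_free pB)).
rewrite /height; move: (intbasis V) (intbasis_primitive V) (intbasisE V).
move: pB eB; case: _ / ek => pB eB A pA eA.
have [X eX] : exists X, A = X *m B by apply: primitive_rows_factor => //; rewrite eA eB.
have [Y eY] : exists Y, B = Y *m A by apply: primitive_rows_factor => //; rewrite eA eB.
have := congr1 (@maxminor _ _) eX; have := congr1 (@maxminor _ _) eY.
rewrite !maxminorM => eB1 eA1.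
have gA := maxminor_gt0 (primitive_rows_free pA).
have gB := maxminor_gt0 (primitive_rows_free pB).
move: eB1 eA1 gA gB; move: (maxminor A) (maxminor B) `|_|%N `|_|%N => a b x y.
case: x => [|x]; first by lia.
case: y => [|y]; first by lia.
by rewrite !mulSn => *; lia.
Qed.

Lemma height_gt0 n (V : 'M[rat]_n) : (0 < height V)%N.
Proof. exact/maxminor_gt0/primitive_rows_free/intbasis_primitive. Qed.

Lemma eq_height n (V W : 'M[rat]_n) : (V :=: W)%MS -> height V = height W.
Proof.
move=> e; apply: (heightE (intbasis_primitive W)).
by apply: (eqmx_trans (intbasisE W)); apply: eqmx_sym.
Qed.

Lemma basisP k n (V : 'M[rat]_n) : \rank V = k ->
  exists2 B : 'M[int]_(k, n), primitive_rows B & (B^Q :=: V)%MS.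
Proof. by move=> <-; exists (intbasis V); [exact: intbasis_primitive | exact: intbasisE]. Qed.

Lemma unitmxQ k (A : 'M[int]_k) : A \in unitmx -> A^Q \in unitmx.
Proof. by rewrite !unitmxE det_map_mx; apply: rmorph_unit. Qed.

Lemma flag_basis k n (B : 'M[int]_(k, n)) (V' : 'M[rat]_n) :
  primitive_rows B -> (B^Q <= V')%MS -> \rank V' = (k + 1)%N ->
  exists2 z : 'rV[int]_n, primitive_rows (col_mx B z) & ((col_mx B z)^Q :=: V')%MS.
Proof.
move=> pB sB rV'; have [B' pB' eB'] := basisP rV'.
have [X eX] : exists X, B = X *m B' by apply: primitive_rows_factor => //; rewrite eB'.
have pX : primitive_rows X by case: pB => C BC; exists (B' *m C); rewrite mulmxA -eX.
have [Y uXY] := primitive_rows_complete pX.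
have e : col_mx B (Y *m B') = col_mx X Y *m B' by rewrite mul_col_mx -eX.
exists (Y *m B'); rewrite e.
  case: pB' => C B'C; exists (C *m invmx (col_mx X Y)).
  by rewrite mulmxA -(mulmxA (col_mx X Y)) B'C mulmx1 mulmxV.
have h : (col_mx X Y *m B')^Q = (col_mx X Y)^Q *m B'^Q by rewrite mapQM.
apply: (eqmx_trans _ eB'); rewrite h; apply/eqmxMfull; rewrite row_full_unit.
exact: unitmxQ.
Qed.

(** The Smith form of P identifies the quotient by its row lattice with a product of
    cyclic groups of total order |det P|. *)
Lemma index_reps k (P : 'M[int]_k) : \det P != 0 ->
  exists s : seq 'rV[int]_k,
    [/\ uniq s, size s = `|\det P|%N,
        {in s &, forall a b, (exists x, a - b = x *m P) -> a = b} &
        forall a, exists2 b, b \in s & exists x, a - b = x *m P].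
Proof.
move=> detP0; have [L uL [R uR [d _ eP]]] := int_Smith_normal_form P.
pose D : 'M[int]_k := diag_mx (\row_i d`_i).
have eD : (\matrix_(i, j) (d`_i *+ (i == j :> nat)) : 'M[int]_k) = D.
  by apply/matrixP=> i j; rewrite !mxE.
rewrite eD in eP.
have eabs : `|\det P|%N = (\prod_(i < k) `|(d`_i)%R|)%N.
  rewrite eP !det_mulmx !abszM det_diag.
  have u1 (A : 'M[int]_k) : A \in unitmx -> `|\det A|%N = 1%N.
    by rewrite unitmxE => /orP[] /eqP ->.
  rewrite !u1 // mul1n muln1 (big_morph _ abszM (erefl : `|1%R|%N = 1%N)).
  by apply: eq_bigr => i _; rewrite mxE.
have d0 i : d`_(i : 'I_k) != 0.
  have : `|\det P|%N != 0%N by rewrite absz_eq0.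
  rewrite eabs.
  by apply: contraNneq => di0; rewrite (bigD1 i) //= di0.
have dP i : (`|(d`_(i : 'I_k))%R| <= `|\det P|)%N.
  rewrite eabs (bigD1 i) //= leq_pmulr // prodn_cond_gt0 // => j _.
  by rewrite absz_gt0.
pose M := `|\det P|%N.+1.
pose F (i : 'I_k) := [pred y : 'I_M | (y < `|(d`_i)%R|)%N].
pose r (g : {ffun 'I_k -> 'I_M}) : 'rV[int]_k := \row_i (g i : nat)%:Z.
have key (g h : {ffun 'I_k -> 'I_M}) : g \in family F -> h \in family F ->
    (exists x, r g - r h = x *m D) -> g = h.
  move=> /familyP gF /familyP hF [x ex]; apply/ffunP=> i; apply/val_inj => /=.
  have := congr1 (fun A : 'rV_k => A 0 i) ex; rewrite mul_mx_diag !mxE => e.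
  have := gF i; have := hF i; rewrite !inE => h1 h2.
  have [x0|x0] := eqVneq (x 0 i) 0; first by move: e; rewrite x0 mul0r; lia.
  have := congr1 absz e; rewrite abszM.
  have : (`|(d`_i)%R| <= `|x 0%R i| * `|(d`_i)%R|)%N by rewrite leq_pmull // absz_gt0.
  move: (`|_| * `|_|)%N => y; move: h1 h2; clear; move: (g i : nat) (h i : nat) => u v.
  by lia.
have RK : forall a : 'rV[int]_k, a *m R *m invmx R = a by move=> a; rewrite mulmxK.
have LDR (x : 'rV[int]_k) : x *m P = (x *m L *m D) *m R by rewrite eP !mulmxA.
exists [seq r g *m R | g <- enum (family F)]; split.
- rewrite map_inj_in_uniq ?enum_uniq // => g h; rewrite !mem_enum => gF hF e.
  apply: key => //; exists 0; rewrite mul0mx -(RK (r g)) e RK subrr //.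
- rewrite size_map -cardE card_family foldrE big_map big_enum eabs /=.
  apply: eq_bigr => i _; rewrite -[RHS]card_ord.
  have le : (`|(d`_i)%R| <= M)%N by apply: leq_trans (dP i) _.
  rewrite -(fintype.card_image (f := widen_ord le)); last by move=> x y /(congr1 val) /= /val_inj.
  apply: eq_card => y; rewrite [LHS]inE; apply/idP/fintype.imageP => [h|[x _ ->]].
    by exists (Ordinal h) => //; apply/val_inj.
  by case: x.
- move=> _ _ /mapP[g gF ->] /mapP[h hF ->] [x ex]; congr (r _ *m R).
  rewrite !mem_enum in gF hF; apply: key => //; exists (x *m L).
  by rewrite -(RK (r g - r h)) mulmxBl ex LDR RK.
- move=> a; have [b ea] : exists b : 'rV_k, a = b *m R.
    by exists (a *m invmx R); rewrite mulmxKV.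
  have lt (i : 'I_k) : (`|(b (0 : 'I_1)%R i %% d`_i)%Z| < M)%N.
    apply: leq_trans (dP i); have := ltz_mod (b 0%R i) (d0 i).
    have := modz_ge0 (b 0%R i) (d0 i); lia.
  exists (r [ffun i => Ordinal (lt i)] *m R).
    apply/mapP; exists [ffun i => Ordinal (lt i)] => //; rewrite mem_enum.
    apply/familyP => i; rewrite ffunE inE /=.
    have h (u v : int) : 0 <= u -> u < `|v| -> (`|u| < `|v|)%N by lia.
    exact: h (modz_ge0 _ (d0 i)) (ltz_mod _ (d0 i)).
  exists ((\row_i (b (0 : 'I_1)%R i %/ d`_i)%Z) *m invmx L).
  rewrite LDR -(mulmxA _ (invmx L)) mulVmx // mulmx1 ea -mulmxBl.
  congr (_ *m R); apply/rowP => i; rewrite mul_mx_diag !mxE ffunE /=.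
  by rewrite gez0_abs ?modz_ge0 //; apply/eqP; rewrite subr_eq -divz_eq.
Qed.

Definition orth n (V : 'M[rat]_n) : 'M[rat]_n := <<kermx V^T>>%MS.

Lemma sub_orth p n (V : 'M[rat]_n) (W : 'M[rat]_(p, n)) :
  (W <= orth V)%MS = (W *m V^T == 0).
Proof. by rewrite genmxE sub_kermx. Qed.

Lemma rank_orth n (V : 'M[rat]_n) : \rank (orth V) = (n - \rank V)%N.
Proof. by rewrite genmxE mxrank_ker mxrank_tr. Qed.

Lemma orthS n (V W : 'M[rat]_n) : (V <= W)%MS -> (orth W <= orth V)%MS.
Proof.
case/submxP=> X ->; rewrite sub_orth trmx_mul mulmxA.
by have := submx_refl (orth W); rewrite sub_orth => /eqP ->; rewrite mul0mx.
Qed.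

Lemma orthK n (V : 'M[rat]_n) : (orth (orth V) :=: V)%MS.
Proof.
have s : (V <= orth (orth V))%MS.
  have := submx_refl (orth V); rewrite !sub_orth => /eqP e.
  by rewrite -[V *m _]trmxK trmx_mul trmxK e trmx0.
apply/eqmx_sym/eqmxP; rewrite -mxrank_leqif_eq //.
by rewrite !rank_orth subKn // rank_leq_col.
Qed.

Lemma orth_inj n (V W : 'M[rat]_n) : <<V>>%MS = V -> <<W>>%MS = W -> orth V = orth W -> V = W.
Proof.
move=> gV gW e; rewrite -gV -gW; apply: eq_genmx.
have h := orthK V; rewrite e in h.
exact: (eqmx_trans (eqmx_sym h) (orthK W)).
Qed.

Lemma extend_inj k m (f : 'I_k -> 'I_(k + m)) : injective f ->
  exists2 h : 'I_(k + m) -> 'I_(k + m), bijective h & forall i, h (lshift m i) = f i.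
Proof.
move=> fI; pose A := f @: 'I_k.
have cA : #|~: A| = m by have := cardsC A; rewrite card_imset // !card_ord; lia.
pose g (j : 'I_m) := enum_val (cast_ord (esym cA) j).
pose h x := match split x with inl i => f i | inr j => g j end.
have gA j : g j \notin A by have := enum_valP (cast_ord (esym cA) j); rewrite inE.
have fA i : f i \in A by apply/imset_f.
exists h; last first.
  by move=> i; rewrite /h; case: splitP => j /= e; [congr f; apply/val_inj | have := ltn_ord i; lia].
apply: injF_bij => x y; rewrite /h.
case: (splitP x) => i ei; case: (splitP y) => j ej.
- by move/fI => eij; apply/val_inj; rewrite /= ei ej eij.
- by move=> e; have := fA i; rewrite e (negPf (gA j)).
- by move=> e; have := fA j; rewrite -e (negPf (gA i)).
- by move/enum_val_inj/cast_ord_inj => eij; apply/val_inj; rewrite /= ei ej eij.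
Qed.

(** Complete a basis B of V to a unimodular matrix U. The last columns of the inverse of
    U form a basis of the orthogonal of V, and a minor of U equals, up to sign, the
    complementary minor of its inverse. *)
Lemma height_orth_le k m (V : 'M[rat]_(k + m)) : \rank V = k -> (height V <= height (orth V))%N.
Proof.
move=> rV; have [B pB eB] := basisP rV.
have [Y uU] := primitive_rows_complete pB; set U := col_mx B Y in uU.
pose W := (rsubmx (invmx U))^T.
have UU : U *m invmx U = 1%:M by rewrite mulmxV.
have UUb : block_mx (B *m lsubmx (invmx U)) (B *m rsubmx (invmx U))
      (Y *m lsubmx (invmx U)) (Y *m rsubmx (invmx U)) = 1%:M.
  by rewrite -mul_col_row hsubmxK.
have [_ BW _ YW] : [/\ B *m lsubmx (invmx U) = 1%:M, B *m rsubmx (invmx U) = 0,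
      Y *m lsubmx (invmx U) = 0 & Y *m rsubmx (invmx U) = 1%:M].
  by move: UUb; rewrite scalar_mx_block => /eq_block_mx.
have pW : primitive_rows W by exists Y^T; rewrite -trmx_mul YW trmx1.
have eW : (W^Q :=: orth V)%MS.
  apply/eqmxP; rewrite -mxrank_leqif_eq; last first.
    have [X ->] : exists X, V = X *m B^Q by apply/submxP; rewrite eB.
    rewrite sub_orth trmx_mul mulmxA.
    suff -> : W^Q *m (B^Q)^T = 0 by rewrite mul0mx.
    by apply: trmx_inj; rewrite trmx_mul trmxK map_trmx trmxK -mapQM BW map_mx0 trmx0.
  by rewrite rank_orth rV (eqP (primitive_rows_free pW)) addKn.
rewrite (heightE pB eB) (heightE pW eW).
have [f ef] := maxminor_attained (maxminor_gt0 (primitive_rows_free pB)).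
have fI : injective f.
  move=> i j eij; apply/eqP; apply: contraTT (maxminor_gt0 (primitive_rows_free pB)) => ne.
  rewrite -ef lt0n negbK absz_eq0 -det_tr.
  by apply/eqP/(determinant_alternate ne) => l; rewrite !mxE eij.
have [h hb hf] := extend_inj fI.
have hUU : colsub h U *m rowsub h (invmx U) = 1%:M.
  rewrite -UU; apply/matrixP => i j; rewrite !mxE [RHS](reindex h) /=; last exact: onW_bij.
  by apply: eq_bigr => l _; rewrite !mxE.
have [uh _] := mulmx1_unit hUU.
set A := colsub f B in ef.
pose g (j : 'I_m) := h (rshift k j).
apply: leq_trans (minor_le W g); rewrite -ef.
have -> : colsub g W = (drsubmx (rowsub h (invmx U)))^T by apply/matrixP=> i j; rewrite !mxE.
rewrite det_tr; set H := rowsub h _ in hUU *.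
have eA : A = ulsubmx (colsub h U).
  by apply/matrixP=> i j; rewrite !mxE hf; case: splitP => l e; [congr (B _ _); apply/val_inj|have := ltn_ord i; move: e => /=; lia].
have e : colsub h U *m block_mx 1%:M (ursubmx H) 0 (drsubmx H)
       = block_mx A 0 (dlsubmx (colsub h U)) 1%:M.
  have := hUU; rewrite -{1}(submxK (colsub h U)) -{1}(submxK H) mulmx_block scalar_mx_block.
  case/eq_block_mx => _ e1 _ e2; rewrite -{1}(submxK (colsub h U)) mulmx_block.
  by rewrite !mulmx1 !mulmx0 !addr0 e1 e2 -eA.
have := congr1 (fun M => `|\det M|%N) e.
rewrite det_mulmx det_ublock det_lblock !det1 mul1r mulr1 abszM => <-.
have -> : `|\det (colsub h U)|%N = 1%N.
  by move: uh; rewrite unitmxE => /orP[] /eqP ->.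
by rewrite mul1n.
Qed.

Lemma height_orth n (V : 'M[rat]_n) : height (orth V) = height V.
Proof.
have le k m (e : n = (k + m)%N) (W : 'M[rat]_n) : \rank W = k -> (height W <= height (orth W))%N.
  by case: _ / (esym e) W => W; exact: height_orth_le.
have rle (W : 'M[rat]_n) : (height W <= height (orth W))%N.
  by apply: (le (\rank W) (n - \rank W)%N) => //; rewrite subnKC // rank_leq_col.
by apply/eqP; rewrite eqn_leq rle andbT -(eq_height (orthK V)) rle.
Qed.

(** * Counting the overspaces of a subspace *)

Lemma flag_basis_top k n (B : 'M[int]_(k, n)) (V' : 'M[rat]_n) :
  primitive_rows B -> (B^Q <= V')%MS -> \rank V' = k.+1 ->
  exists2 z : 'rV[int]_n, primitive_rows (col_mx z B) & ((col_mx z B)^Q :=: V')%MS.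
Proof.
move=> pB sB rV'; have [|z [C BzC] e] := flag_basis pB sB; first by rewrite addn1.
exists z.
  exists (row_mx (rsubmx C) (lsubmx C)).
  move: BzC; rewrite -{1}(hsubmxK C) mul_col_row scalar_mx_block => /eq_block_mx[e1 e2 e3 e4].
  by rewrite mul_col_row e1 e2 e3 e4 -scalar_mx_block.
apply: (eqmx_trans _ e); rewrite !map_col_mx.
apply: (eqmx_trans (eqmx_sym (addsmxE _ _))); apply: (eqmx_trans _ (addsmxE _ _)).
by rewrite addsmxC.
Qed.

(** Cramer: replacing one column of P by another column of B. *)
Lemma adj_minor k n (B : 'M[int]_(k, n)) (f : 'I_k -> 'I_n) i j :
  (\adj (colsub f B) *m B) i j = \det (colsub (fun l => if l == i then j else f l) B).
Proof.
rewrite (expand_det_col _ i) mxE; apply: eq_bigr => l _.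
rewrite !mxE eqxx mulrC; congr (_ * (_ * \det _)).
by apply/matrixP=> a b; rewrite !mxE eq_sym (negPf (neq_lift _ _)).
Qed.

Section SubspaceList.
Variables (n k h : nat).

Definition decode (M : 'M['I_(h + h).+1]_(k, n)) : 'M[rat]_n :=
  <<(map_mx (fun x : 'I_(h + h).+1 => (x : nat)%:Z - h%:Z) M)^Q>>%MS.

(** Every subspace of height at most h is spanned by integer vectors with entries at
    most h in absolute value, namely the rows of the matrix in [adj_minor]; hence a
    finite list of matrices exhausts them. *)
Definition subspaces : seq 'M[rat]_n :=
  undup [seq V <- [seq decode M | M in [set: 'M['I_(h + h).+1]_(k, n)]]
        | (\rank V == k) && (height V <= h)%N].

Lemma subspaces_uniq : uniq subspaces. Proof. exact: undup_uniq. Qed.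

Lemma mem_subspaces V : V \in subspaces = [&& <<V>>%MS == V, \rank V == k & (height V <= h)%N].
Proof.
rewrite mem_undup mem_filter andbC; apply/andP/and3P => [[/fintype.imageP[M _ ->] /andP[-> ->]]|].
  by rewrite genmx_id eqxx.
move=> [/eqP gV /eqP rV hV]; rewrite rV hV eqxx; split=> //.
have [B pB eB] := basisP rV.
have eh := heightE pB eB; have gB := maxminor_gt0 (primitive_rows_free pB).
have [f ef] := maxminor_attained gB.
pose N := \adj (colsub f B) *m B.
have hN i j : (`|N i j| <= h)%N.
  by apply: leq_trans hV; rewrite adj_minor eh; exact: minor_le.
have d0 : \det (colsub f B) != 0 by rewrite -absz_eq0 ef -lt0n.
have eN : (N^Q :=: B^Q)%MS.
  apply/eqmxP; rewrite /N mapQM submxMl /=.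
  have e : B^Q = ((\det (colsub f B))%:~R)^-1 *: ((colsub f B)^Q *m ((\adj (colsub f B))^Q *m B^Q)).
    rewrite mulmxA -[in X in _ *: (X *m _)]mapQM mul_mx_adj -mapQM mul_scalar_mx.
    by apply/matrixP=> i j; rewrite !mxE rmorphM mulKf // intr_eq0.
  by rewrite {1}e; apply/scalemx_sub/submxMl.
apply/fintype.imageP; exists (\matrix_(i, j) inord `|(N i j + h%:Z)%R|%N) => //.
rewrite /decode -gV; apply: eq_genmx.
rewrite (_ : (map_mx _ _) = N); first exact: (eqmx_trans (eqmx_sym eB) (eqmx_sym eN)).
apply/matrixP=> i j; have := hN i j; rewrite !mxE => hh.
by rewrite inordK; lia.
Qed.

End SubspaceList.

Lemma pigeonhole (T : eqType) (K : finType) (D : {pred K}) (F : T -> K) (s : seq T) :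
  {in s, forall a, F a \in D} -> s != [::] ->
  exists2 a0, a0 \in s & (size s <= #|D| * count (fun a => F a == F a0) s)%N.
Proof.
move=> FD s0.
have [a0 a0s amax] : exists2 a0, a0 \in s &
    forall a, a \in s -> (count (fun b => F b == F a) s <= count (fun b => F b == F a0) s)%N.
  have gs : (0 < size s)%N by rewrite lt0n size_eq0.
  have [i _ im] := @arg_maxnP _ (Ordinal gs) xpredT
    (fun i : 'I_(size s) => count (fun b => F b == F (tnth (in_tuple s) i)) s) isT.
  exists (tnth (in_tuple s) i); first exact: mem_tnth.
  by move=> a /(tnthP (in_tuple s))[j ->]; exact: im.
exists a0 => //.
have -> : size s = (\sum_(c in D) count (fun b => F b == c) s)%N.
  rewrite -sum1_size; under [RHS]eq_bigr do rewrite -sum1_count.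
  rewrite (exchange_big_dep predT) //= !big_seq; apply: eq_bigr => a /FD aD.
  rewrite (bigD1 (F a)) ?aD ?eqxx //= big1 // => c /andP[/andP[_ /eqP->]].
  by rewrite eqxx.
rewrite -sum_nat_const; apply: leq_sum => c _.
have [/hasP[a sa /eqP <-]|] := boolP (has (fun b => F b == c) s); first exact: amax.
by rewrite has_count -leqNgt leqn0 => /eqP ->.
Qed.

Section OneStep.
Variables (k n : nat) (V : 'M[rat]_n) (B : 'M[int]_(k, n)) (f : 'I_k -> 'I_n).
Hypotheses (pB : primitive_rows B) (eB : (B^Q :=: V)%MS) (ef : `|\det (colsub f B)|%N = height V).
Local Notation t := (height V).
Local Notation P := (colsub f B).

Let detP0 : \det P != 0. Proof. by rewrite -absz_eq0 ef -lt0n height_gt0. Qed.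

Let uP : P^Q \in unitmx.
Proof. by rewrite unitmxE det_map_mx unitfE intr_eq0. Qed.

Let fI : injective f.
Proof.
move=> i j eij; apply/eqP; apply: contraTT isT => ne; move: detP0.
by rewrite -det_tr (determinant_alternate ne) ?eqxx // => l; rewrite !mxE eij.
Qed.

Let A : 'M[rat]_(k, n) := invmx P^Q *m B^Q.

(** The part of z transverse to V: the difference between z and the point of V with the
    same coordinates f. *)
Let residue (z : 'rV[int]_n) : 'rV[rat]_n := z^Q - (colsub f z)^Q *m A.

Let residueE z : (z^Q = (colsub f z)^Q *m invmx P^Q *m B^Q + residue z).
Proof. by rewrite /residue /A mulmxA addrC subrK. Qed.

Let Af : colsub f A = 1%:M.
Proof. by rewrite /A -mulmx_colsub -map_mxsub mulVmx. Qed.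

Let residue_f z i : residue z 0 (f i) = 0.
Proof.
have : colsub f (residue z) = 0.
  by rewrite /residue raddfB /= -mulmx_colsub Af mulmx1 -map_mxsub subrr.
by move=> /rowP/(_ i); rewrite !mxE.
Qed.

Let minor_residue z g :
  ((\det (colsub g (col_mx z B)))%:~R : rat) = \det (colsub g (col_mx (residue z) B^Q)).
Proof.
rewrite -det_map_mx map_mxsub map_col_mx.
have -> : col_mx z^Q B^Q = block_mx 1%:M ((colsub f z)^Q *m invmx P^Q) 0 1%:M *m
     col_mx (residue z) B^Q.
  by rewrite mul_block_col !mul1mx mul0mx add0r {1}residueE addrC.
by rewrite -mulmx_colsub det_mulmx det_ublock !det1 !mul1r.
Qed.

Let minor_residue_le z (d : rat) : 0 <= d ->
  (forall j, `|residue z 0 j| <= d) -> (maxminor (col_mx z B))%:R <= k.+1%:R * d * t%:R.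
Proof.
move=> d0 rd; case: (posnP (maxminor (col_mx z B))) => [->|]; first by rewrite !mulr_ge0 ?ler0n.
move/maxminor_attained=> [g <-].
rewrite natr_absz intr_norm minor_residue (expand_det_row _ (lshift k ord0)).
apply: le_trans (ler_norm_sum _ _ _) _.
have -> : k.+1%:R * d * t%:R = \sum_(j < 1 + k) d * t%:R.
  by rewrite sumr_const card_ord -[RHS]mulr_natl mulrA.
apply: ler_sum => j _; rewrite normrM; apply: ler_pM => //.
  by rewrite mxE col_mxEu.
have -> : cofactor (colsub g (col_mx (residue z) B^Q)) (lshift k ord0) j =
    (-1) ^+ (lshift k (ord0 : 'I_1) + j) * (\det (colsub (g \o lift j) B))%:~R.
  rewrite /cofactor -det_map_mx; congr (_ * \det _); apply/matrixP=> a b.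
  have el : lift (lshift k (ord0 : 'I_1)) a = rshift 1 a by apply/val_inj.
  by rewrite [LHS]mxE [LHS]mxE [LHS]mxE el col_mxEd !mxE.
rewrite normrM normrX normrN1 expr1n mul1r -intr_norm -natr_absz ler_nat.
by rewrite (heightE pB eB) minor_le.
Qed.

Let residue_le z j : `|residue z 0 j| * t%:R <= (maxminor (col_mx z B))%:R.
Proof.
pose g (i : 'I_(1 + k)) := match split i with inl _ => j | inr i => f i end.
apply: le_trans (_ : (`|\det (colsub g (col_mx z B))|%N)%:R <= _); last first.
  by rewrite ler_nat minor_le.
rewrite natr_absz intr_norm minor_residue.
have -> : colsub g (col_mx (residue z) B^Q) =
   block_mx (residue z 0 j)%:M 0 (colsub (fun _ : 'I_1 => j) B^Q) P^Q.
  apply/matrixP=> a b; rewrite !mxE /g.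
  case: (splitP a) => a' ea; rewrite ?mxE; case: (splitP b) => b' eb; rewrite ?mxE ?ord1 ?eqxx //.
  by have := residue_f z b'; rewrite !mxE.
rewrite det_lblock det_scalar1 normrM det_map_mx -intr_norm -natr_absz ef.
by [].
Qed.

Let zof (a : 'rV[int]_k) : 'rV[int]_n := \row_j Num.floor ((a^Q *m A) 0 j).

Let zof_f a : colsub f (zof a) = a.
Proof.
apply/rowP=> i; rewrite !mxE.
have -> : (\sum_j a^Q 0 j * A j (f i)) = (a 0 i)%:~R; last by rewrite intrKfloor.
have := congr1 (fun M => (a^Q *m M) 0 i) Af; rewrite mulmx1 !mxE => <-.
by apply: eq_bigr => l _; rewrite !mxE.
Qed.

Let frac_zof a j : 0 <= (a^Q *m A) 0 j - (zof a 0 j)%:~R < 1.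
Proof.
rewrite [zof a 0 j]mxE subr_ge0 floor_le /= ltrBlDl.
by have := floorD1_gt ((a^Q *m A) 0 j); rewrite rmorphD.
Qed.

Let zof_residue a j : residue (zof a) 0 j = - ((a^Q *m A) 0 j - (zof a 0 j)%:~R).
Proof. by rewrite /residue zof_f opprB !mxE. Qed.

Let card_off_f q (y : 'I_q.+1) : #|pffun_on y [predC codom f] predT| = (q.+1 ^ (n - k))%N.
Proof.
rewrite card_pffun_on card_ord; congr (_ ^ _)%N.
have := cardC (mem (codom f)); rewrite card_codom // !card_ord => h; rewrite -[X in (X - _)%N]h addKn; exact: eq_card.
Qed.

(** An overspace is V + z with z unique up to the integral points of V, so that the
    coordinates f of z may be taken in the list s of t representatives. The minors on f
    and one more coordinate show that each residue of z is at most h / t in absolute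
    value, which leaves about 2 h / t values for each of the other n - k coordinates. *)
Lemma overspaces_of_basis_le h :
  (size [seq V' <- subspaces n k.+1 h | (V <= V')%MS]
     <= t * (h %/ t + h %/ t).+2 ^ (n - k))%N.
Proof.
have t0 : (0 < t)%N := height_gt0 V.
set q := (h %/ t)%N.
have [s [us ss _ sall]] := index_reps detP0.
have P1 (V' : 'M[rat]_n) : V' \in [seq V' <- subspaces n k.+1 h | (V <= V')%MS] ->
  exists z : 'rV[int]_n, [/\ colsub f z \in s, (V' :=: V + z^Q)%MS &
     forall j, `|residue z 0 j| * t%:R <= h%:R].
  rewrite mem_filter mem_subspaces => /andP[VV' /and3P[_ /eqP rV' hV']].
  have [|z pz ez] := flag_basis_top pB _ rV'; first by rewrite eB.
  have [b bs [x ex]] := sall (colsub f z).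
  have eh := heightE pz ez.
  have ezB : col_mx z B = block_mx 1%:M x 0 1%:M *m col_mx (z - x *m B) B.
    by rewrite mul_block_col !mul1mx mul0mx add0r subrK.
  exists (z - x *m B); split.
  - by rewrite raddfB /= -mulmx_colsub -ex opprB addrC subrK.
  - apply: (eqmx_trans (eqmx_sym ez)); rewrite ezB mapQM.
    apply: (@eqmx_trans _ _ _ _ _ _ (col_mx (z - x *m B) B)^Q).
      apply: eqmxMfull; rewrite row_full_unit; apply: unitmxQ.
      by rewrite unitmxE det_ublock !det1 mulr1 unitr1.
    rewrite map_col_mx; apply: (eqmx_trans (eqmx_sym (addsmxE _ _))).
    by rewrite addsmxC; apply: adds_eqmx.
  - move=> j; apply: le_trans (residue_le _ _) _; rewrite ler_nat.
    apply: leq_trans hV'; rewrite eh ezB maxminorM.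
    by rewrite det_ublock !det1 mulr1 mul1n.
pose zz (V' : 'M[rat]_n) := if pselect (exists z : 'rV[int]_n, [/\ colsub f z \in s, (V' :=: V + z^Q)%MS &
     forall j, `|residue z 0 j| * t%:R <= h%:R]) is left e then sval (cid e) else 0.
have zzP (V' : 'M[rat]_n) : V' \in [seq V' <- subspaces n k.+1 h | (V <= V')%MS] ->
  [/\ colsub f (zz V') \in s, (V' :=: V + (zz V')^Q)%MS &
     forall j, `|residue (zz V') 0 j| * t%:R <= h%:R].
  by move=> /P1; rewrite /zz; case: pselect => // e _; exact: (svalP (cid e)).
(* Shifting by q makes the offset from the rounded point a natural number below
   2 q + 2, equal to q on the coordinates f. *)
pose e (V' : 'M[rat]_n) j := zz V' 0 j - zof (colsub f (zz V')) 0 j + q%:Z.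
have eP (V' : 'M[rat]_n) j : V' \in [seq V' <- subspaces n k.+1 h | (V <= V')%MS] -> (`|e V' j| < (q + q).+2)%N /\ 0 <= e V' j.
  move=> /zzP[_ _ /(_ j)]; rewrite /residue /e.
  set a := colsub f _; set z := zz V' => hr.
  have := frac_zof a j; rewrite !mxE in hr *.
  have hq : (h < q.+1 * t)%N by rewrite /q ltn_ceil.
  have t0' : (0 : rat) < t%:R by rewrite ltr0n.
  have hq' : (h%:R : rat) < q.+1%:R * t%:R by rewrite -natrM ltr_nat.
  set x := \sum_j _ in hr *; move=> /andP[x0 x1].
  have : `|(z 0 j)%:~R - x| < q.+1%:R by rewrite -(ltr_pM2r t0'); apply: le_lt_trans hr _.
  rewrite ltr_norml => /andP[h1 h2].
  have l1 : - (q.+1%:Z) < z 0 j - Num.floor x.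
    rewrite -(ltr_int rat) rmorphB rmorphN /=; move: h1 x0; rewrite -[q.+1%:~R]/(q.+1%:R); lra.
  have l2 : z 0 j - Num.floor x < q.+2%:Z.
    rewrite -(ltr_int rat) rmorphB /= -[q.+2%:~R]/(q.+2%:R) -[q.+2]addn1 natrD; move: h2 x1; lra.
  by move: l1 l2; move: (z 0 j - _) => y; clear; split; lia.
pose code (V' : 'M[rat]_n) : 'rV[int]_k * {ffun 'I_n -> 'I_(q + q).+2} :=
  (colsub f (zz V'), [ffun j => inord `|e V' j|%N]).
have eq_z V' : zz V' = \row_j (zof (colsub f (zz V')) 0 j - q%:Z + e V' j).
  by apply/rowP=> j; rewrite [RHS]mxE /e; ring.
have codeI : {in [seq V' <- subspaces n k.+1 h | (V <= V')%MS] &, injective code}.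
  move=> V1 V2 m1 m2 [ea /ffunP ee].
  have ez : zz V1 = zz V2.
    rewrite eq_z [RHS]eq_z ea; apply/rowP=> j; rewrite [LHS]mxE [RHS]mxE; congr (_ + _).
    have := congr1 val (ee j); rewrite !ffunE /= !inordK; try by case: (eP _ j m1); case: (eP _ j m2).
    by case: (eP _ j m1) => _ ? ; case: (eP _ j m2) => _ ?; lia.
  have := m1; have := m2; rewrite !mem_filter !mem_subspaces => /and4P[_ /eqP <- _ _] /and4P[_ /eqP <- _ _].
  apply: eq_genmx; have [_ e1 _] := zzP _ m1; have [_ e2 _] := zzP _ m2.
  by rewrite ez in e1; exact: (eqmx_trans e1 (eqmx_sym e2)).
rewrite -(size_map code) -ef -ss -(card_off_f (inord q)) cardE -(size_allpairs pair).
apply: uniq_leq_size; first by rewrite map_inj_in_uniq // filter_uniq // subspaces_uniq.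
move=> _ /mapP[V' mV' ->]; apply/allpairsP; exists (code V'); split=> //.
  by have [] := zzP _ mV'.
rewrite mem_enum; apply/pffun_onP; split=> //; apply/fintype.subsetP => j.
rewrite !inE ffunE; apply: contra => /codomP[i ->].
rewrite /e; have := zof_f (colsub f (zz V')) => /rowP/(_ i); rewrite !mxE => ->.
by rewrite subrr add0r.
Qed.

Let coord_mod (V' : 'M[rat]_n) : (V <= V')%MS -> \rank V' = k.+1 ->
  exists c : 'rV[int]_n -> int, forall z, (z^Q <= V')%MS ->
    [/\ maxminor (col_mx z B) = (`|c z| * height V')%N,
        c z = 0 -> (z^Q <= V)%MS &
        forall z', (z'^Q <= V')%MS -> c z = c z' -> exists y, z - z' = y *m B].
Proof.
move=> VV' rV'; have [|z0 pz ez] := flag_basis_top pB _ rV'; first by rewrite eB.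
have [C zC] := pz.
have fac z : (z^Q <= V')%MS -> z = lsubmx (z *m C) *m z0 + rsubmx (z *m C) *m B.
  rewrite -ez => /(primitive_rows_factor pz)[w ew].
  have -> : z *m C = w by rewrite ew -mulmxA zC mulmx1.
  by rewrite -mul_row_col hsubmxK.
exists (fun z => (z *m C) 0 (lshift k 0)) => z /fac ez0.
have e11 u : lsubmx (u *m C) = ((u *m C) 0 (lshift k 0))%:M.
  by apply/matrixP=> i j; rewrite !ord1 !mxE eqxx.
split.
- rewrite (heightE pz ez) {1}ez0.
  have -> : col_mx (lsubmx (z *m C) *m z0 + rsubmx (z *m C) *m B) B =
     block_mx (lsubmx (z *m C)) (rsubmx (z *m C)) 0 1%:M *m col_mx z0 B.
    by rewrite mul_block_col mul1mx mul0mx add0r.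
  by rewrite maxminorM det_ublock det1 mulr1 e11 det_scalar1.
- rewrite {2}ez0 e11 => ->; rewrite -eB.
  by rewrite mul_scalar_mx scale0r add0r mapQM submxMl.
- move=> z' /fac ez0' e; exists (rsubmx (z *m C) - rsubmx (z' *m C)).
  by rewrite mulmxBl {1}ez0 {1}ez0' !e11 e opprD addrACA subrr add0r.
Qed.

(** Round the point of V above each of the t representatives to an integral point. By
    the pigeonhole principle t / N^(n-k) of the rounding errors fall in one cube of side
    1 / N; the differences z of the corresponding integral points have residues less
    than 1 / N, so that V + z has height at most (k + 1) t / N. An overspace V + z0
    receives those z that are congruent to i z0 modulo V for some i, and |i| is at most
    H divided by its height. *)
Lemma overspaces_of_basis_mass_ge N H : (0 < N)%N -> (k.+1 * t <= H * N)%N ->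
  (t <= N ^ (n - k) *
     (1 + \sum_(V' <- subspaces n k.+1 H | (V <= V')%MS) 2 * (H %/ height V')))%N.
Proof.
case: N => // N _ HN.
have [s [us ss sinj _]] := index_reps detP0.
pose x a j : rat := N.+1%:R * ((a^Q *m A) 0 j - (zof a 0 j)%:~R).
have xE a j : residue (zof a) 0 j = - (N.+1%:R^-1 * x a j).
  by rewrite zof_residue /x mulKf ?pnatr_eq0.
pose F (a : 'rV[int]_k) : {ffun 'I_n -> 'I_N.+1} :=
  [ffun j => inord (absz (Num.floor (x a j)))].
have Fv a j : (F a j : nat) = absz (Num.floor (x a j)) /\ 0 <= Num.floor (x a j).
  have /andP[x0 x1] := frac_zof a j.
  have h0 : 0 <= Num.floor (x a j) by rewrite floor_ge0 mulr_ge0.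
  have h1 : Num.floor (x a j) < N.+1%:Z.
    by rewrite floor_lt_int -[N.+1%:~R]/(N.+1%:R) -[ltRHS]mulr1 ltr_pM2l // ltr0n.
  by rewrite ffunE inordK //; lia.
have FD : {in s, forall a, F a \in pffun_on ord0 [predC codom f] predT}.
  move=> a _; apply/pffun_onP; split=> //; apply/fintype.subsetP => j.
  rewrite !inE; apply: contra => /codomP[i ->]; apply/eqP/val_inj => /=.
  have [-> _] := Fv a (f i); have := residue_f (zof a) i.
  by rewrite xE => /eqP; rewrite oppr_eq0 mulf_eq0 invr_eq0 pnatr_eq0 /= => /eqP ->; rewrite floor0.
have sne : s != [::] by rewrite -size_eq0 ss absz_eq0.
have [a0 a0s] := pigeonhole FD sne; rewrite card_off_f ss ef => hs.
apply: leq_trans hs _; rewrite leq_mul2l; apply/orP; right.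
pose s' := [seq a <- s | (F a == F a0) && (a != a0)].
have -> : count (fun a => F a == F a0) s = (1 + size s')%N.
  rewrite -size_filter -(count_predC (pred1 a0)) count_uniq_mem ?filter_uniq //.
  rewrite mem_filter eqxx a0s /= /s' count_filter size_filter; congr addn.
  by apply: eq_count => a /=; rewrite andbC.
rewrite leq_add2l.
pose dz (a : 'rV[int]_k) : 'rV[int]_n := zof a - zof a0.
pose W (a : 'rV[int]_k) : 'M[rat]_n := <<(V + (dz a)^Q)%MS>>%MS.
have dz_f a : colsub f (dz a) = a - a0 by rewrite raddfB /= !zof_f.
have key a : a \in s' -> [/\ a \in s, (maxminor (col_mx (dz a) B) <= H)%N & ~~ ((dz a)^Q <= V)%MS].
  rewrite mem_filter => /andP[/andP[/eqP eF ne] sa]; split=> //.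
    have hr j : `|residue (dz a) 0 j| <= N.+1%:R^-1.
      have -> : residue (dz a) 0 j = - (N.+1%:R^-1 * (x a j - x a0 j)).
        rewrite mulrBr opprB addrC -xE -[X in _ = _ + X]opprK -xE /residue /dz.
        by rewrite map_mxB raddfB /= map_mxB mulmxBl !mxE; ring.
      rewrite normrN normrM normfV normr_nat ger_pMr ?invr_gt0 ?ltr0n //.
      have [e1 p1] := Fv a j; have [e2 p2] := Fv a0 j.
      have := floor_itv (x a j); have := floor_itv (x a0 j).
      have -> : Num.floor (x a j) = Num.floor (x a0 j) by move: e1 e2; rewrite eF; lia.
      rewrite rmorphD /=; move=> /andP[h1 h2] /andP[h3 h4].
      rewrite ler_norml; lra.
    have := minor_residue_le _ hr; rewrite invr_ge0 ler0n => /(_ isT).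
    rewrite mulrAC -natrM ler_pdivlMr ?ltr0n // -natrM ler_nat => h.
    have := leq_trans h HN; rewrite leq_pmul2r //.
  apply: contraNN ne => h; apply/eqP/sinj => //.
  have [|y ey] := @primitive_rows_factor _ _ _ B (dz a) pB; first by rewrite eB.
  by exists y; rewrite -dz_f ey mulmx_colsub.
have WL a : a \in s' -> W a \in [seq V' <- subspaces n k.+1 H | (V <= V')%MS].
  move=> /key[sa hH hV]; rewrite mem_filter mem_subspaces /W genmx_id eqxx genmxE addsmxSl /=.
  have rV : \rank V = k by rewrite -eB (eqP (primitive_rows_free pB)).
  have rW : \rank (W a) = k.+1.
    apply/eqP; rewrite eqn_leq genmxE; apply/andP; split.
      apply: leq_trans (mxrank_adds_leqif _ _) _; rewrite rV addnC.
      by rewrite -(add1n k) leq_add2r rank_leq_row.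
    rewrite -rV; apply: rank_ltmx; rewrite /ltmx addsmxSl /=.
    by apply: contra hV; apply: submx_trans; exact: addsmxSr.
  have [|c hc] := @coord_mod (W a) _ rW; first by rewrite genmxE addsmxSl.
  have [|e1 e2 _] := hc (dz a); first by rewrite genmxE addsmxSr.
  rewrite -[\rank _]/(\rank _) rW eqxx /=; apply: leq_trans hH; rewrite e1 leq_pmull // absz_gt0.
  by apply: contraNneq hV => /e2.
have -> : size s' = (\sum_(V' <- subspaces n k.+1 H | (V <= V')%MS) count (fun a => W a == V') s')%N.
  rewrite -sum1_size -[RHS]big_filter; under [RHS]eq_bigr do rewrite -sum1_count.
  rewrite (exchange_big_dep predT) //= big_seq [RHS]big_seq; apply: eq_bigr => a /WL aL.
  rewrite sum1_count (eq_count (a2 := pred1 (W a))); last by move=> V'; rewrite /= eq_sym.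
  by rewrite count_uniq_mem ?filter_uniq ?subspaces_uniq // aL.
rewrite big_seq_cond [leqRHS]big_seq_cond; apply: leq_sum => V' /andP[].
rewrite mem_subspaces => /and3P[_ /eqP rV' _] VV'.
have [c hc] := coord_mod VV' rV'.
rewrite -size_filter; set s'' := [seq _ <- _ | _].
have dzV' a : a \in s'' -> ((dz a)^Q <= V')%MS.
  by rewrite mem_filter => /andP[/eqP <- _]; rewrite genmxE addsmxSr.
pose m := (H %/ height V')%N.
rewrite -(size_map (fun a => c (dz a))).
have -> : (2 * m)%N = size ([seq i.+1%:Z | i <- iota 0 m] ++ [seq - i.+1%:Z | i <- iota 0 m]).
  by rewrite size_cat !size_map !size_iota mul2n addnn.
apply: uniq_leq_size.
  rewrite map_inj_in_uniq ?filter_uniq // => a b sa sb e.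
  have [_ _ h] := hc _ (dzV' _ sa); have [y ey] := h _ (dzV' _ sb) e.
  have := sa; have := sb; rewrite !mem_filter => /and3P[_ _ sb'] /and3P[_ _ sa'].
  apply: sinj => //; exists y.
  by rewrite mulmx_colsub -ey raddfB /= !dz_f opprB addrA subrK.
move=> _ /mapP[a sa ->]; have [e1 e2 _] := hc _ (dzV' _ sa).
have [|_ hH hV] := key a; first by move: sa; rewrite mem_filter => /andP[].
have c0 : c (dz a) != 0 by apply: contraNneq hV => /e2.
have cm : (`|c (dz a)| <= m)%N by rewrite /m leq_divRL ?height_gt0 // -e1.
move: (c (dz a)) c0 cm => y c0 cm.
rewrite mem_cat; apply/orP; case: (leP 0 y) => h; [left|right].
  by apply/mapP; exists (`|y|.-1)%N; [rewrite mem_iota|]; move: c0 cm h; clear; lia.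
by apply/mapP; exists (`|y|.-1)%N; [rewrite mem_iota|]; move: c0 cm h; clear; lia.
Qed.

End OneStep.

(** * Dyadic levels of height *)

Local Close Scope ring_scope.

Lemma minor_basis k n (V : 'M[rat]_n) : \rank V = k ->
  exists (B : 'M[int]_(k, n)) (f : 'I_k -> 'I_n),
    [/\ primitive_rows B, (map_mx (intr : int -> rat) B :=: V)%MS & absz (\det (colsub f B))%R = height V].
Proof.
move=> rV; have [B pB eB] := basisP rV.
have [f ef] := maxminor_attained (maxminor_gt0 (primitive_rows_free pB)).
by exists B, f; rewrite ef (heightE pB eB).
Qed.

Lemma overspaces_le n k h (V : 'M[rat]_n) : \rank V = k ->
  size [seq V' <- subspaces n k.+1 h | (V <= V')%MS]
     <= height V * (h %/ height V + h %/ height V).+2 ^ (n - k).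
Proof. by move=> /minor_basis[B [f [pB eB ef]]]; apply: overspaces_of_basis_le pB eB ef _. Qed.

Lemma overspaces_mass_ge n k N H (V : 'M[rat]_n) : \rank V = k -> 0 < N -> k.+1 * height V <= H * N ->
  height V <= N ^ (n - k) *
     (1 + \sum_(V' <- subspaces n k.+1 H | (V <= V')%MS) 2 * (H %/ height V')).
Proof. by move=> /minor_basis[B [f [pB eB ef]]]; apply: overspaces_of_basis_mass_ge pB eB ef _ _. Qed.

Lemma subspaces_orth n k h (V : 'M[rat]_n) : k <= n -> <<V>>%MS = V ->
  perm_eq [seq orth W | W <- subspaces n k h & (W <= V)%MS]
          [seq W <- subspaces n (n - k) h | (orth V <= W)%MS].
Proof.
move=> kn gV; apply: uniq_perm.
- rewrite map_inj_in_uniq ?filter_uniq ?subspaces_uniq // => W1 W2.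
  rewrite !mem_filter !mem_subspaces => /and4P[_ /eqP g1 _ _] /and4P[_ /eqP g2 _ _].
  exact: orth_inj.
- by rewrite filter_uniq ?subspaces_uniq.
move=> W; apply/mapP/idP => [[U]|].
  rewrite !mem_filter !mem_subspaces => /and4P[UV _ /eqP rU hU] ->.
  by rewrite orthS // genmx_id eqxx rank_orth rU eqxx height_orth hU.
rewrite mem_filter mem_subspaces => /and4P[VW /eqP gW /eqP rW hW]; exists (orth W).
  rewrite mem_filter mem_subspaces genmx_id eqxx rank_orth rW subKn // eqxx height_orth hW !andbT /=.
  by have := orthS VW; rewrite orthK.
by apply: esym; rewrite -[in RHS]gW; apply: eq_genmx; apply: (eqmx_trans (eqmx_sym (genmxE _)) (orthK W)).
Qed.

(** This is [overspaces_le] for the orthogonal of V. *)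
Lemma hyperplanes_le n k h (V : 'M[rat]_n) : \rank V = k.+1 -> <<V>>%MS = V ->
  size [seq W <- subspaces n k h | (W <= V)%MS]
     <= height V * (h %/ height V + h %/ height V).+2 ^ k.+1.
Proof.
move=> rV gV; have kn : k.+1 <= n by rewrite -rV rank_leq_col.
rewrite -(size_map (@orth n)) (perm_size (subspaces_orth h (ltnW kn) gV)).
have rO : \rank (orth V) = (n - k.+1) by rewrite rank_orth rV.
have := overspaces_le h rO; rewrite height_orth subKn //.
by have -> : (n - k.+1).+1 = n - k by lia.
Qed.

Lemma hyperplanes_mass_ge n k N H (V : 'M[rat]_n) : \rank V = k.+1 -> <<V>>%MS = V -> 0 < N ->
  (n - k) * height V <= H * N ->
  height V <= N ^ k.+1 *
     (1 + \sum_(W <- subspaces n k H | (W <= V)%MS) 2 * (H %/ height W)).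
Proof.
move=> rV gV N0; have kn : k.+1 <= n by rewrite -rV rank_leq_col.
have rO : \rank (orth V) = (n - k.+1) by rewrite rank_orth rV.
have := @overspaces_mass_ge _ _ N H _ rO N0; rewrite height_orth subKn //.
have -> : (n - k.+1).+1 = n - k by lia.
rewrite -big_filter -(perm_big _ (subspaces_orth H (ltnW kn) gV)) big_map big_filter.
by under eq_bigr do rewrite height_orth.
Qed.

Definition level_subspaces n k i := [seq V <- subspaces n k (2 ^ i.+1).-1 | 2 ^ i <= height V].

Lemma mem_level_subspaces n k i V : V \in level_subspaces n k i =
  [&& <<V>>%MS == V, \rank V == k, 2 ^ i <= height V & height V < 2 ^ i.+1].
Proof.
rewrite mem_filter mem_subspaces -(ltnS (height V)) prednK ?expn_gt0 //.
by rewrite andbC -!andbA; congr [&& _, _ & _]; rewrite andbC.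
Qed.

Lemma sum_levels n k J (P : pred 'M[rat]_n) (F : 'M[rat]_n -> nat) :
  \sum_(V <- subspaces n k (2 ^ J.+1).-1 | P V) F V =
  \sum_(l < J.+1) \sum_(V <- level_subspaces n k l | P V) F V.
Proof.
have e (l : 'I_J.+1) : perm_eq (level_subspaces n k l)
    [seq V <- subspaces n k (2 ^ J.+1).-1 | trunc_log 2 (height V) == l].
  apply: uniq_perm; rewrite ?filter_uniq ?subspaces_uniq // => V.
  rewrite mem_level_subspaces mem_filter mem_subspaces.
  case: (<<V>>%MS == V); case: (\rank V == k) => //=; rewrite ?andbF ?andbT //.
  have h0 := height_gt0 V; have hJ : 0 < 2 ^ J.+1 by rewrite expn_gt0.
  apply/andP/andP => [[h1 h2]|[/eqP <- h2]].
    rewrite (trunc_log_eq _ (n := l)) ?h1 //; split=> //.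
    suff : 2 ^ l.+1 <= 2 ^ J.+1 by lia.
    by rewrite leq_exp2l.
  by have /andP[] := trunc_log_bounds (isT : 1 < 2) h0.
under [RHS]eq_bigr => l _ do rewrite (perm_big _ (e l)) big_filter_cond.
rewrite (exchange_big_dep P) /=; last by move=> l V _ /andP[].
rewrite big_seq_cond [RHS]big_seq_cond; apply: eq_bigr => V /andP[+ PV].
rewrite mem_subspaces => /and3P[_ _ hV].
have lt : trunc_log 2 (height V) < J.+1.
  have hJ : 0 < 2 ^ J.+1 by rewrite expn_gt0.
  have := trunc_logP (isT : 1 < 2) (height_gt0 V) => h1.
  by rewrite -(ltn_exp2l _ _ (isT : 1 < 2)); lia.
rewrite (bigD1 (Ordinal lt)) /=; last by rewrite PV eqxx.
rewrite big1 ?addn0 // => l /andP[/andP[/eqP h _] /eqP[]].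
by apply/val_inj; rewrite /= h.
Qed.

Lemma sum_pow_geo a J : 0 < a -> \sum_(l < J.+1) 2 ^ (a * l) <= 2 * 2 ^ (a * J).
Proof.
move=> a0; elim: J => [|J IH]; first by rewrite big_ord_recr big_ord0 /= muln0.
rewrite big_ord_recr /=; apply: leq_trans (leq_add IH (leqnn _)) _.
have : 2 * 2 ^ (a * J) <= 2 ^ (a * J.+1) by rewrite -expnS leq_exp2l // mulnS; lia.
lia.
Qed.

Lemma size_subspaces_le n k h : size (subspaces n k h) <= (h + h).+1 ^ (k * n).
Proof.
apply: leq_trans (size_undup _) _; apply: leq_trans (_ : size _ <= _).
  by rewrite size_filter; exact: count_size.
by rewrite size_map -cardE cardsT card_mx card_ord.
Qed.

Lemma expn2_gt0 l : 0 < 2 ^ l. Proof. by rewrite expn_gt0. Qed.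

Lemma leq_exp_base m n e : m <= n -> m ^ e <= n ^ e.
Proof. by case: e => // e h; rewrite leq_exp2r. Qed.

Lemma dyadic_count_le a b h t l e : 2 ^ l <= t -> t < 2 ^ l.+1 -> h <= 2 ^ e -> l <= e ->
  b <= t * (h %/ t + h %/ t).+2 ^ a -> b <= 2 ^ (l.+1 + a * (e - l + 2)).
Proof.
move=> t1 t2 he le_le hb; apply: leq_trans hb _; rewrite expnD.
apply: leq_mul; first exact: ltnW.
rewrite mulnC expnM; apply: leq_exp_base.
have : h %/ t <= 2 ^ (e - l).
  apply: leq_trans (leq_div2l h (expn2_gt0 l) t1) _.
  by apply: leq_trans (leq_div2r _ he) _; rewrite -expnB.
rewrite expnD; have : 0 < 2 ^ (e - l) by rewrite expn_gt0.
lia.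
Qed.

Lemma level_overspaces_le n k i l e (V : 'M[rat]_n) : V \in level_subspaces n k l -> i < e -> l <= e ->
  count (fun V' => V <= V')%MS (level_subspaces n k.+1 i) <= 2 ^ (l.+1 + (n - k) * (e - l + 2)).
Proof.
rewrite mem_level_subspaces => /and4P[_ /eqP rV h1 h2] ie le_le.
apply: (dyadic_count_le (h := (2 ^ i.+1).-1) h1 h2 _ le_le).
  by apply: leq_trans (leq_pred _) _; rewrite leq_exp2l.
apply: leq_trans (overspaces_le (2 ^ i.+1).-1 rV).
by rewrite size_filter count_filter; apply: sub_count => V' /andP[].
Qed.

Lemma level_hyperplanes_le n k i l e (V : 'M[rat]_n) : V \in level_subspaces n k.+1 l -> i < e -> l <= e ->
  count (fun W => W <= V)%MS (level_subspaces n k i) <= 2 ^ (l.+1 + k.+1 * (e - l + 2)).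
Proof.
rewrite mem_level_subspaces => /and4P[/eqP gV /eqP rV h1 h2] ie le_le.
apply: (dyadic_count_le (h := (2 ^ i.+1).-1) h1 h2 _ le_le).
  by apply: leq_trans (leq_pred _) _; rewrite leq_exp2l.
apply: leq_trans (hyperplanes_le (2 ^ i.+1).-1 rV gV).
by rewrite size_filter count_filter; apply: sub_count => V' /andP[].
Qed.

Lemma sum_div_levels n k J (P : pred 'M[rat]_n) :
  \sum_(V <- subspaces n k (2 ^ J.+1).-1 | P V) 2 * ((2 ^ J.+1).-1 %/ height V) <=
  \sum_(l < J.+1) 2 ^ (J - l + 2) * count P (level_subspaces n k l).
Proof.
rewrite sum_levels; apply: leq_sum => l _.
rewrite -sum1_count big_distrr /= big_seq_cond [leqRHS]big_seq_cond; apply: leq_sum => V.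
rewrite mem_level_subspaces => /andP[/and4P[_ _ h1 _] _].
have lJ := ltn_ord l; rewrite muln1 (_ : J - l + 2 = (J.+1 - l).+1); last by lia.
rewrite [leqRHS]expnS; apply: leq_mul => //.
apply: leq_trans (leq_div2l _ (expn2_gt0 l) h1) _.
by rewrite expnB // ?(ltnW lJ) //; apply/leq_div2r/leq_pred.
Qed.

(** The side of the cubes is 2^(-tau), which puts the overspaces at heights about 2^(i -
    tau). The condition on i says that the pigeonhole principle finds at least two
    points in a cube. *)
Lemma level_overspaces_mass_ge n k i tau (V : 'M[rat]_n) : V \in level_subspaces n k i ->
  tau <= i -> (n - k) * tau < i ->
  2 ^ (i - (n - k) * tau).-1 <=
  \sum_(l < (i - tau + k.+1).+1) 2 ^ (i - tau + k.+1 - l + 2) *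
     count (fun V' => V <= V')%MS (level_subspaces n k.+1 l).
Proof.
rewrite mem_level_subspaces => /and4P[_ /eqP rV h1 h2] ti hi.
set J := i - tau + k.+1.
apply: (leq_trans _ (@sum_div_levels n k.+1 J (fun V' => V <= V')%MS)).
have := @overspaces_mass_ge n k (2 ^ tau) (2 ^ J.+1).-1 V rV; rewrite expn_gt0 => /(_ isT).
set S := \sum_(_ <- _ | _) _ => h.
have /h {}h : k.+1 * height V <= (2 ^ J.+1).-1 * 2 ^ tau.
  have e1 : 2 ^ i.+1 = 2 ^ (i - tau) * 2 * 2 ^ tau by rewrite -expnSr -expnD; congr (_ ^ _); lia.
  have e2 : 2 ^ J.+1 = 2 ^ (i - tau) * 2 ^ k.+2 by rewrite -expnD; congr (_ ^ _); lia.
  have e4 : k.+1 * 2 < 2 ^ k.+2 by rewrite expnS mulnC ltn_pmul2l // ltn_expl.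
  have p1 : 0 < 2 ^ (i - tau) by rewrite expn_gt0.
  have p2 : 0 < 2 ^ tau by rewrite expn_gt0.
  apply: leq_trans (leq_mul (leqnn _) (ltnW h2)) _; rewrite e1 mulnA leq_mul2r; apply/orP; right.
  by rewrite e2; nia.
have : 2 ^ (i - (n - k) * tau) <= 1 + S.
  rewrite -(leq_pmul2l (m := 2 ^ ((n - k) * tau))) ?expn_gt0 // -expnD subnKC ?(ltnW hi) //.
  by apply: leq_trans h1 _; rewrite (mulnC (n - k)) expnM.
have -> : i - (n - k) * tau = (i - (n - k) * tau).-1.+1 by rewrite prednK // subn_gt0.
rewrite expnS /=; have : 0 < 2 ^ (i - (n - k) * tau).-1 by rewrite expn_gt0.
lia.
Qed.

Lemma level_hyperplanes_mass_ge n k i (V : 'M[rat]_n) : V \in level_subspaces n k.+1 i -> 0 < i ->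
  2 ^ i.-1 <= \sum_(l < (i + n).+1) 2 ^ (i + n - l + 2) *
     count (fun W => W <= V)%MS (level_subspaces n k l).
Proof.
rewrite mem_level_subspaces => /and4P[/eqP gV /eqP rV h1 h2] hi.
apply: (leq_trans _ (@sum_div_levels n k (i + n) (fun W => W <= V)%MS)).
have := @hyperplanes_mass_ge n k 1 (2 ^ (i + n).+1).-1 V rV gV isT; rewrite exp1n mul1n muln1.
set S := \sum_(_ <- _ | _) _ => h.
have /h {}h : (n - k) * height V <= (2 ^ (i + n).+1).-1.
  have kn : k.+1 <= n by rewrite -rV rank_leq_col.
  have e1 : 2 ^ (i + n).+1 = 2 ^ i.+1 * 2 ^ n by rewrite -expnD.
  have e3 : n < 2 ^ n by apply: ltn_expl.
  have p1 : 0 < 2 ^ i.+1 by rewrite expn_gt0.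
  by rewrite e1; nia.
move: h h1; rewrite -{1}(prednK hi) expnS.
have : 0 < 2 ^ i.-1 by rewrite expn_gt0.
lia.
Qed.

(** * Descent from hyperplanes to points *)

Lemma count_exchange (T U : eqType) (r : T -> U -> bool) (s : seq T) (t : seq U) :
  \sum_(x <- s) count (r x) t = \sum_(y <- t) count (r^~ y) s.
Proof.
under eq_bigr do rewrite -sum1_count; under [RHS]eq_bigr do rewrite -sum1_count.
by rewrite (exchange_big_dep predT).
Qed.

Lemma sum_seq_const (T : Type) (s : seq T) c : \sum_(x <- s) c = size s * c.
Proof. by rewrite -sum1_size big_distrl /=; apply: eq_bigr => x _; rewrite mul1n. Qed.

Lemma sum_seq_le (T : eqType) (s : seq T) (F : T -> nat) c :
  {in s, forall x, F x <= c} -> \sum_(x <- s) F x <= size s * c.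
Proof.
move=> h; rewrite -sum_seq_const; rewrite big_seq [leqRHS]big_seq.
exact: leq_sum.
Qed.

(** Double counting of the incidences between dimensions k and k + 1, at equal heights:
    each subspace of dimension k + 1 and height 2^i has total mass about 2^i of
    hyperplanes of height at most about 2^i. *)
Lemma level_count n k : 0 < k -> k < n ->
  exists C, forall i, size (level_subspaces n k i) <= C * 2 ^ (n * i).
Proof.
elim: k => // -[_ _ n1|k /(_ isT) IH _ kn].
  exists (2 ^ (n * 2)) => i; rewrite -expnD -mulnDr mulnC.
  apply: leq_trans (_ : size (subspaces n 1 (2 ^ i.+1).-1) <= _).
    by rewrite size_filter count_size.
  apply: leq_trans (size_subspaces_le _ _ _) _; rewrite mul1n expnM; apply: leq_exp_base.
  rewrite addnC expnD expnS; have := expn2_gt0 i; lia.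
have [C hC] := IH (ltnW kn).
pose m := (n - k.+1).
have [c ec] : exists c, c = 4 + 3 * m + n.+1 * n by eexists.
exists (size (level_subspaces n k.+2 0) + C * 2 ^ c.+1) => i.
case: (posnP i) => [->|i0]; first by rewrite muln0 muln1 leq_addr.
apply: leq_trans (_ : C * 2 ^ c.+1 * 2 ^ (n * i) <= _); last by rewrite leq_mul2r leq_addl orbT.
rewrite -(leq_pmul2r (expn2_gt0 i.-1)).
set J := (i + n).
apply: leq_trans (_ : \sum_(V' <- level_subspaces n k.+2 i) \sum_(l < J.+1) 2 ^ (J - l + 2) *
     count (fun W => W <= V')%MS (level_subspaces n k.+1 l) <= _).
  rewrite -sum_seq_const big_seq [leqRHS]big_seq; apply: leq_sum => V' mV'.
  exact: level_hyperplanes_mass_ge.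
rewrite exchange_big /=.
apply: leq_trans (_ : \sum_(l < J.+1) C * 2 ^ (J + 3 + 3 * m + m * J) * 2 ^ (k.+1 * l) <= _).
  apply: leq_sum => l _; rewrite -big_distrr /=.
  rewrite (count_exchange (fun V' W => W <= V')%MS).
  have lJ : l <= J by rewrite -ltnS.
  apply: leq_trans (_ : 2 ^ (J - l + 2) * (size (level_subspaces n k.+1 l) * 2 ^ (l.+1 + m * (J.+1 - l + 2))) <= _).
    rewrite leq_mul2l; apply/orP; right; apply: sum_seq_le => W mW.
    by apply: level_overspaces_le => //; [rewrite ltnS leq_addr|exact: leqW].
  apply: leq_trans (leq_mul (leqnn _) (leq_mul (hC l) (leqnn _))) _.
  rewrite mulnCA -!mulnA leq_mul2l; apply/orP; right; rewrite -!expnD leq_exp2l //.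
  have := subnKC (ltnW kn); rewrite -/m; move: (nat_of_ord l) lJ => q lJ en.
  have [p eJ] : exists p, J = p + q by exists (J - q); rewrite subnK.
  by rewrite eJ -addSn !addnK -en; nia.
rewrite -big_distrr /=; apply: leq_trans (leq_mul (leqnn _) (sum_pow_geo _ (isT : 0 < k.+1))) _.
rewrite -!mulnA leq_mul2l; apply/orP; right; rewrite -expnS -!expnD leq_exp2l //.
rewrite ec /J; have := subnKC (ltnW kn); rewrite -/m.
by move=> h; rewrite -{2 4}h; nia.
Qed.

(** What remains of the geometry of the zero set in the descent. *)
Definition sections_bounded n (Z : pred 'M[rat]_n) d := forall k h (V : 'M[rat]_n),
  \rank V = k.+1 -> ~~ Z V -> count (fun W => (W <= V)%MS && Z W) (subspaces n k h) <= d.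

Lemma sections_bounded_level n (Z : pred 'M[rat]_n) d k i l (V : 'M[rat]_n) :
  sections_bounded Z d -> V \in level_subspaces n k.+1 l -> ~~ Z V ->
  count (fun W => (W <= V)%MS && Z W) (level_subspaces n k i) <= d.
Proof.
move=> hZ; rewrite mem_level_subspaces => /and4P[_ /eqP rV _ _] nZ.
apply: leq_trans (hZ k (2 ^ i.+1).-1 V rV nZ).
by rewrite count_filter; apply: sub_count => W /andP[].
Qed.

(** This is 2^(k J) times the sum of height^(-k) over the subspaces in Z of dimension k
    and height below 2^(J + 1). It is the sum that appears on the right of the double
    counting one dimension lower. *)
Definition weight n (Z : pred 'M[rat]_n) k J :=
  \sum_(l < J.+1) count Z (level_subspaces n k l) * 2 ^ (k * (J - l)).

Lemma weightS n (Z : pred 'M[rat]_n) k J :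
  weight Z k J.+1 = 2 ^ k * weight Z k J + count Z (level_subspaces n k J.+1).
Proof.
rewrite /weight big_ord_recr /= subnn muln0 muln1; congr addn.
rewrite big_distrr /=; apply: eq_bigr => l _; rewrite mulnCA -expnD -mulnS subSn //.
by rewrite -ltnS.
Qed.

Definition weight_bound n k C := forall (Z : pred 'M[rat]_n) d tau,
  sections_bounded Z d -> ~~ Z 1%:M%R -> d <= 2 ^ (n * tau) ->
  forall J, weight Z k J <= C * 2 ^ ((n - k) * tau + n.-1 * J).

(** There are at most C 2^(n l) hyperplanes of level l, and at most d of them lie in Z;
    the two bounds balance at l = tau. *)
Lemma weight_bound_hyperplanes k : 0 < k -> exists C, weight_bound k.+1 k C.
Proof.
move=> k0; have [C hC] := level_count k0 (ltnSn k).
exists (2 * C + 1) => Z d tau hZ nZ hd J; rewrite subSnn mul1n /=.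
have ad l : count Z (level_subspaces k.+1 k l) <= 2 ^ (k.+1 * tau).
  apply: leq_trans hd; apply: leq_trans (hZ k (2 ^ l.+1).-1 1%:M%R _ nZ); last by rewrite mxrank1.
  by rewrite count_filter; apply: sub_count => W /andP[] -> _; rewrite submx1.
have low K : weight Z k K <= 2 * C * 2 ^ (k * K + K).
  apply: leq_trans (_ : \sum_(l < K.+1) C * 2 ^ (k * K) * 2 ^ (1 * l) <= _).
    apply: leq_sum => l _; apply: leq_trans (leq_mul (leq_trans (count_size _ _) (hC l)) (leqnn _)) _.
    rewrite -!mulnA leq_mul2l; apply/orP; right; rewrite -!expnD leq_exp2l //.
    have : l <= K by rewrite -ltnS.
    move: (nat_of_ord l) => q qK; have [p ->] : exists p, K = p + q by exists (K - q); rewrite subnK.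
    by rewrite addnK; nia.
  rewrite -big_distrr /=; apply: leq_trans (leq_mul (leqnn _) (sum_pow_geo _ (isT : 0 < 1))) _.
  by rewrite mul1n expnD; apply: eq_leq; ring.
have [Jt|tJ] := leqP J tau.
  apply: leq_trans (low J) _; rewrite mulnDl mul1n.
  apply: leq_trans (leq_addr _ _); rewrite leq_mul2l leq_exp2l //; apply/orP; right; lia.
have [p ->] : exists p, J = p + tau by exists (J - tau); rewrite subnK // ltnW.
(* With X the added term, each new level contributes at most X to the weight W, and
   2^k W + X + X <= 2^k (W + X). *)
suff : weight Z k (p + tau) + 2 ^ (k.+1 * tau) <= (2 * C + 1) * 2 ^ (tau + k * (p + tau)).
  by apply: leq_trans; rewrite leq_addr.
elim: p => [|p IH].
  rewrite add0n mulnDl mul1n; apply: leq_add; last by rewrite mulSn.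
  by apply: leq_trans (low tau) _; rewrite addnC.
rewrite addSn weightS.
have e : 2 ^ (tau + k * (p + tau).+1) = 2 ^ k * 2 ^ (tau + k * (p + tau)).
  by rewrite -expnD; congr (_ ^ _); rewrite mulnS; lia.
rewrite e mulnCA; apply: leq_trans (leq_mul (leqnn (2 ^ k)) IH).
have : 2 <= 2 ^ k by rewrite -{1}(expn1 2) leq_exp2l.
have := ad (p + tau).+1; move: (2 ^ (_ * tau)) (count _ _) (2 ^ k) (weight _ _ _); nia.
Qed.

(** Double counting of the pairs V < V' with V in Z of level i and V' of dimension k + 1
    and level about i - tau: by [level_overspaces_mass_ge] each V has mass about 2^(i -
    (n - k) tau), a V' outside Z contains at most d such V, and a V' in Z is controlled
    by [level_hyperplanes_le] and by the weight in dimension k + 1. For levels i up to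
    (n - k) tau the trivial bound of [level_count] is enough. *)
Lemma weight_bound_step n k C' : 0 < k -> k.+1 < n ->
  weight_bound n k.+1 C' -> exists C, weight_bound n k C.
Proof.
move=> k0 kn hC'; have [C0 h0] := level_count k0 (ltnW kn); have [C1 h1] := level_count (ltn0Sn k) kn.
have [r en] : exists r, n = k + r.+2 by exists (n - k.+2); lia.
have [D eD] : exists D, D = C1 * 2 ^ (n * k.+1 + 3) + C' * 2 ^ (n * k.+1 + 3 * k.+1 + 3) by eexists.
exists (2 * (C0 + 2 * D)) => Z d tau hZ nZ hd.
have em : n - k = r.+2 by lia.
have em1 : n - k.+1 = r.+1 by lia.
have en1 : n.-1 = k + r.+1 by lia.
have ha i : count Z (level_subspaces n k i) <= (C0 + 2 * D) * 2 ^ (r.+2 * tau + n.-1 * i).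
  have [itau|taui] := leqP i (r.+2 * tau).
    apply: leq_trans (leq_trans (count_size _ _) (h0 i)) _.
    apply: leq_mul; first exact: leq_addr.
    rewrite leq_exp2l // en1 {1}en; nia.
  have ti : tau <= i by apply: leq_trans (ltnW taui); rewrite leq_pmull.
  apply: leq_trans (_ : 2 * D * 2 ^ (r.+2 * tau + n.-1 * i) <= _); last by rewrite leq_mul2r leq_addl orbT.
  have [q eq] : exists q, i = (r.+2 * tau + q).+1 by exists (i - (r.+2 * tau).+1); lia.
  rewrite -(leq_pmul2r (expn2_gt0 q)).
  have -> : 2 * D * 2 ^ (r.+2 * tau + n.-1 * i) * 2 ^ q = D * 2 ^ (n * i).
    rewrite -!mulnA mulnCA -expnD -expnS; congr (_ * 2 ^ _).
    by rewrite en1 en; nia.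
  set J := i - tau + k.+1.
  have lower V : V \in level_subspaces n k i -> 2 ^ q <= \sum_(l < J.+1) 2 ^ (J - l + 2) *
     count (fun V' => V <= V')%MS (level_subspaces n k.+1 l).
    move=> mV; have := level_overspaces_mass_ge mV ti; rewrite em => /(_ taui).
    by have -> : (i - r.+2 * tau).-1 = q by lia.
  apply: leq_trans (_ : \sum_(V <- [seq V <- level_subspaces n k i | Z V]) \sum_(l < J.+1) 2 ^ (J - l + 2) *
     count (fun V' => V <= V')%MS (level_subspaces n k.+1 l) <= _).
    rewrite -size_filter -sum_seq_const big_seq [leqRHS]big_seq; apply: leq_sum => V.
    by rewrite mem_filter => /andP[_ mV]; exact: lower.
  rewrite exchange_big /=.
  have Jt : J + tau = i + k.+1 by rewrite /J; lia.
  apply: leq_trans (_ : \sum_(l < J.+1) (2 ^ (J - l + 2) * (size (level_subspaces n k.+1 l) * 2 ^ (n * tau))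
      + 2 ^ (J - l + 2) * (count Z (level_subspaces n k.+1 l) * 2 ^ (l.+1 + k.+1 * (J + tau.+1 - l + 2)))) <= _).
    apply: leq_sum => l _; rewrite -big_distrr /=.
    rewrite (count_exchange (fun V V' => V <= V')%MS) -mulnDr leq_mul2l; apply/orP; right.
    have lJ : l <= J by rewrite -ltnS.
    apply: leq_trans (_ : \sum_(V' <- level_subspaces n k.+1 l) (2 ^ (n * tau) +
        Z V' * 2 ^ (l.+1 + k.+1 * (J + tau.+1 - l + 2))) <= _).
      rewrite big_seq [leqRHS]big_seq; apply: leq_sum => V' mV'.
      rewrite count_filter; case: (boolP (Z V')) => ZV'; last first.
        rewrite addn0; apply: leq_trans hd.
        exact: (sections_bounded_level i hZ mV' ZV').
      rewrite mul1n; apply: leq_trans (leq_addl _ _).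
      apply: leq_trans (level_hyperplanes_le (e := J + tau.+1) mV' _ _).
      - by apply: sub_count => W /andP[].
      - by clear -Jt; lia.
      - by clear -lJ; lia.
    rewrite big_split /= sum_seq_const leq_add2l -big_distrl leq_mul2r; apply/orP; right.
    by rewrite -sum1_count [leqRHS]big_mkcond; apply: eq_leq; apply: eq_bigr => V' _; case: (Z V').
  rewrite big_split /= eD mulnDl; apply: leq_add.
    apply: leq_trans (_ : \sum_(l < J.+1) C1 * 2 ^ (J + 2 + n * tau) * 2 ^ (n.-1 * l) <= _).
      apply: leq_sum => l _.
      apply: leq_trans (leq_mul (leqnn _) (leq_mul (h1 l) (leqnn _))) _.
      rewrite mulnCA -!mulnA leq_mul2l; apply/orP; right; rewrite -!expnD leq_exp2l // en1 {1}en.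
      have : l <= J by rewrite -ltnS.
      move: (nat_of_ord l) => w wJ; clear -wJ; have [p ->] : exists p, J = p + w by exists (J - w); rewrite subnK.
      by rewrite addnK; nia.
    have n1 : 0 < n.-1 by rewrite en1 addnS.
    rewrite -big_distrr /=; apply: leq_trans (leq_mul (leqnn _) (sum_pow_geo _ n1)) _.
    rewrite -!mulnA leq_mul2l; apply/orP; right; rewrite -expnS -!expnD leq_exp2l //.
    have -> : n * k.+1 + 3 + n * i = 3 + n * (J + tau) by rewrite Jt; ring.
    rewrite en1 {1 2}en; nia.
  apply: leq_trans (_ : 2 ^ (J + 3 + k.+1 * (tau + 3)) * weight Z k.+1 J <= _).
    rewrite /weight big_distrr /=; apply: leq_sum => l _.
    rewrite mulnCA [leqRHS]mulnCA leq_mul2l; apply/orP; right; rewrite -!expnD leq_exp2l //.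
    have : l <= J by rewrite -ltnS.
    move: (nat_of_ord l) => w wJ; clear -wJ; have [p ->] : exists p, J = p + w by exists (J - w); rewrite subnK.
    by rewrite addnAC !addnK; nia.
  apply: leq_trans (leq_mul (leqnn _) (hC' Z d tau hZ nZ hd J)) _.
  rewrite mulnCA -!mulnA leq_mul2l; apply/orP; right; rewrite -!expnD leq_exp2l //.
  have -> : n * k.+1 + 3 * k.+1 + 3 + n * i = 3 + 3 * k.+1 + n * (J + tau) by rewrite Jt; ring.
  rewrite em1 en1 {1}en; nia.
move=> J; rewrite em en1.
apply: leq_trans (_ : \sum_(l < J.+1) (C0 + 2 * D) * 2 ^ (r.+2 * tau + k * J) * 2 ^ (r.+1 * l) <= _).
  apply: leq_sum => l _; apply: leq_trans (leq_mul (ha l) (leqnn _)) _.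
  rewrite -!mulnA leq_mul2l; apply/orP; right; rewrite -!expnD leq_exp2l // en1.
  have : l <= J by rewrite -ltnS.
  move: (nat_of_ord l) => q qK; have [p ->] : exists p, J = p + q by exists (J - q); rewrite subnK.
  by rewrite addnK; nia.
rewrite -big_distrr /=; apply: leq_trans (leq_mul (leqnn _) (sum_pow_geo _ (isT : 0 < r.+1))) _.
rewrite mulnCA -!mulnA !leq_mul2l /=; apply/orP; right; rewrite -!expnD leq_exp2l //; nia.
Qed.

Lemma weight_bound_points n : 1 < n -> exists C, weight_bound n 1 C.
Proof.
move=> n1.
suff h k : k < n.-1 -> exists C, weight_bound n (n.-1 - k) C.
  by have := h n.-2; have -> : n.-1 - n.-2 = 1 by [lia]; apply; lia.
elim: k => [|k IH] kn.
  rewrite subn0; have := @weight_bound_hyperplanes n.-1.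
  by rewrite prednK //; [apply; lia | lia].
have [C hC] := IH (ltnW kn).
have e : n.-1 - k = (n.-1 - k.+1).+1 by lia.
by rewrite e in hC; apply: weight_bound_step hC; lia.
Qed.

Theorem point_count_bound n : 1 < n -> exists C, forall (Z : pred 'M[rat]_n) d tau,
  sections_bounded Z d -> ~~ Z 1%:M%R -> d <= 2 ^ (n * tau) ->
  forall J, count Z (subspaces n 1 (2 ^ J.+1).-1) <= C * 2 ^ (n.-1 * (tau + J)).
Proof.
move=> /weight_bound_points[C hC]; exists C => Z d tau hZ nZ hd J.
have := hC Z d tau hZ nZ hd J; rewrite subn1 -mulnDr; apply: leq_trans.
rewrite -sum1_count sum_levels; apply: leq_sum => l _.
by rewrite sum1_count leq_pmulr // expn_gt0.
Qed.

(** * Hyperplanes inside a zero set *)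

Local Open Scope ring_scope.

Section LineRestriction.
Variables (n : nat) (f : {mpoly rat[n]}) (v w : 'rV[rat]_n).

Definition line_poly : {poly rat} :=
  mmap polyC (fun i => (v 0 i)%:P + w 0 i *: 'X) f.

Lemma line_polyE s : line_poly.[s] = f.@[(v + s *: w) 0].
Proof.
rewrite mevalE /line_poly /mmap horner_sum; apply: eq_bigr => m _.
rewrite hornerM hornerC; congr (_ * _); rewrite /mmap1 horner_prod; apply: eq_bigr => i _.
by rewrite horner_exp !hornerE !mxE mulrC.
Qed.

Lemma size_line_poly : (size line_poly <= msize f)%N.
Proof.
rewrite /line_poly /mmap; apply: leq_trans (size_sum _ _ _) _.
apply/bigmax_leqP_seq => m mf _; rewrite mul_polyC.
apply: leq_trans (size_scale_leq _ _) _; apply: leq_trans _ (msize_mdeg_lt mf).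
rewrite /mmap1 mdegE; elim/big_ind2: _ => [|p a q b hp hq|i _]; first by rewrite size_poly1.
  by apply: leq_trans (size_polyMleq _ _) _; move: (size p) (size q) hp hq => x y; lia.
have h : (size ((v ord0 i)%:P + w ord0 i *: 'X)%R <= 2)%N.
  apply: leq_trans (size_polyD _ _) _; rewrite geq_max (leq_trans (size_polyC_leq1 _)) //=.
  by apply: leq_trans (size_scale_leq _ _) _; rewrite size_polyX.
elim: (m i) => [|e IH]; first by rewrite expr0 size_poly1.
rewrite exprS; apply: leq_trans (size_polyMleq _ _) _.
by move: h IH; move: (size (polyseq (_ + _))) (size (polyseq (_ ^+ e))) => x y; lia.
Qed.

End LineRestriction.

Lemma submx_sub p1 p2 n (A B : 'M[rat]_(p1, n)) (C : 'M[rat]_(p2, n)) :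
  (A <= C)%MS -> (B <= C)%MS -> ((A - B)%R <= C)%MS.
Proof. by move=> hA hB; rewrite addmx_sub // eqmx_opp. Qed.

Lemma exists_notin (r : seq rat) : exists c, c \notin r.
Proof.
suff [c hc] : exists c, {in r, forall x, x < c}.
  by exists c; apply/negP => /hc; rewrite ltxx.
elim: r => [|x r [c hc]]; first by exists 0.
exists (Num.max c (x + 1)) => y; rewrite inE lt_max => /orP[/eqP->|/hc ->] //.
by rewrite ltrDl ltr01 orbT.
Qed.

(** Over an infinite field a space is not a finite union of proper subspaces: a line in
    the direction u through a point outside all the earlier subspaces meets each of them
    at most once. *)
Lemma avoid_subspaces n (V : 'M[rat]_n) (s : seq 'M[rat]_n) :
  {in s, forall W, ~~ (V <= W)%MS} ->
  exists2 w : 'rV[rat]_n, (w <= V)%MS & {in s, forall W, ~~ (w <= W)%MS}.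
Proof.
elim: s => [|W s IH] hs; first by exists 0; rewrite ?sub0mx.
have [|w1 w1V w1s] := IH; first by move=> W' mW'; apply: hs; rewrite inE mW' orbT.
have /row_subPn[i uW] := hs W (mem_head _ _); set u := row i V in uW.
have uV : (u <= V)%MS by exact: row_sub.
have [w1W|w1W] := boolP (w1 <= W)%MS; last first.
  by exists w1 => // W'; rewrite inE => /orP[/eqP->|/w1s].
have [r hr] : exists r : seq rat, forall c, c \notin r -> {in s, forall W', ~~ ((w1 + c *: u)%R <= W')%MS}.
  elim: s {IH hs} w1s => [|W' s IH] w1s; first by exists [::].
  have [|r hr] := IH; first by move=> W2 m2; apply: w1s; rewrite inE m2 orbT.
  have [[c0 h0]|h0] := pselect (exists c0, ((w1 + c0 *: u)%R <= W')%MS); last first.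
    exists r => c cr W2; rewrite inE => /orP[/eqP->|]; last exact: hr.
    by apply/negP => h; apply: h0; exists c.
  exists (c0 :: r) => c; rewrite inE negb_or => /andP[cc0 cr] W2; rewrite inE => /orP[/eqP->|]; last exact: hr.
  apply: contra (w1s W' (mem_head _ _)) => h1.
  have uW' : (u <= W')%MS.
    have cc : c - c0 != 0 by rewrite subr_eq0.
    have e : (c - c0)^-1 *: ((w1 + c *: u) - (w1 + c0 *: u)) = u.
      by rewrite opprD addrACA subrr add0r -scalerBl scalerA mulVf ?scale1r.
    rewrite -e scalemx_sub //; exact: (submx_sub h1 h0).
  have e : (w1 + c0 *: u) - c0 *: u = w1 by rewrite addrK.
  by rewrite -e submx_sub // scalemx_sub.
have [c] := exists_notin (0 :: r); rewrite inE negb_or => /andP[c0 cr].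
exists (w1 + c *: u); first by rewrite addmx_sub // scalemx_sub.
move=> W'; rewrite inE => /orP[/eqP->|]; last exact: hr.
apply: contra uW => h.
have e : c^-1 *: ((w1 + c *: u) - w1) = u by rewrite addrC addKr scalerA mulVf ?scale1r.
by rewrite -e scalemx_sub // submx_sub.
Qed.

Definition vanishes n (f : {mpoly rat[n]}) (V : 'M[rat]_n) : bool :=
  `[< forall v : 'rV[rat]_n, (v <= V)%MS -> f.@[v 0] = 0 >].

(** Let v in V be a point where f does not vanish, and let w avoid the hyperplanes W of
    V in the list as well as the spans of v with their pairwise intersections. Then the
    line v + s w meets the W at distinct values of s, all of them roots of the
    restriction of f, which is nonzero at s = 0. *)
Lemma vanishing_sections_bounded n (f : {mpoly rat[n]}) d :
  (msize f <= d.+1)%N -> sections_bounded (vanishes f) d.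
Proof.
move=> fd k h V rV /asboolPn/existsNP[v /not_implyP[vV /eqP fv]].
rewrite -size_filter; set L := filter _ _.
have LP W : W \in L -> [/\ <<W>>%MS = W, \rank W = k, (W <= V)%MS &
    forall u : 'rV[rat]_n, (u <= W)%MS -> f.@[u 0] = 0].
  by rewrite mem_filter mem_subspaces => /andP[/andP[WV /asboolP ZW] /and3P[/eqP gW /eqP rW _]].
have vW W : W \in L -> ~~ (v <= W)%MS.
  by move=> /LP[_ _ _ ZW]; apply: contra fv => /ZW ->.
pose L2 := [seq ((W12.1 :&: W12.2) + v)%MS | W12 <- [seq x <- [seq (W1, W2) | W1 <- L, W2 <- L] | x.1 != x.2]].
have [|w wV wn] := @avoid_subspaces _ V ([seq (W : 'M_n) | W <- L] ++ L2).
  move=> W; rewrite map_id mem_cat => /orP[WL|/mapP[[W1 W2]]].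
    by apply: contra (vW _ WL); apply: submx_trans.
  rewrite mem_filter /= => /andP[ne /allpairsP[[X1 X2] /= [m1 m2 [e1 e2]]]] ->.
  rewrite -{}e1 -{}e2 in m1 m2 *.
  have [g1 r1 _ _] := LP _ m1; have [g2 r2 _ _] := LP _ m2.
  apply/negP => /mxrankS; rewrite rV leqNgt => /negP; apply.
  have lt : (\rank (W1 :&: W2) < k)%N.
    rewrite -r1 ltn_neqAle mxrankS ?capmxSl // andbT; apply: contra ne => e.
    have e1 : (W1 :&: W2 == W1)%MS by rewrite -mxrank_leqif_eq ?capmxSl.
    have s12 : (W1 <= W2)%MS by rewrite -(eqmxP e1) capmxSr.
    rewrite -g1 -g2; apply/eqP/genmxP; rewrite -mxrank_leqif_eq //.
    by rewrite r1 r2.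
  apply: leq_ltn_trans (mxrank_adds_leqif _ _) _.
  by apply: leq_ltn_trans (leq_add (leqnn _) (rank_leq_row v)) _; rewrite addn1.
have dec W : W \in L -> exists s : rat, ((v + s *: w)%R <= W)%MS.
  move=> WL; have [_ rW WV _] := LP _ WL.
  have eV : (W + w == V)%MS.
    rewrite -mxrank_leqif_eq ?addsmx_sub ?WV // eqn_leq mxrankS ?addsmx_sub ?WV //=.
    rewrite rV -rW; apply: rank_ltmx; rewrite /ltmx addsmxSl /= addsmx_sub submx_refl /=.
    by apply: wn; rewrite map_id mem_cat WL.
  have : (v <= W + w)%MS by rewrite (eqmxP eV).
  case/sub_addsmxP=> [[a b]] /= e; exists (- b 0 0).
  have eb : b *m w = b 0 0 *: w by rewrite {1}[b]mx11_scalar mul_scalar_mx.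
  by rewrite e eb scaleNr addrK submxMl.
pose sl (W : 'M[rat]_n) : rat := if pselect (exists s : rat, ((v + s *: w)%R <= W)%MS) is left e then sval (cid e) else 0.
have slP W : W \in L -> ((v + sl W *: w)%R <= W)%MS.
  by move=> /dec; rewrite /sl; case: pselect => // e _; exact: (svalP (cid e)).
have slI : {in L &, injective sl}.
  move=> W1 W2 m1 m2 e; apply/eqP; case: (eqVneq W1 W2) => // ne; exfalso.
  have h1 := slP _ m1; have h2 := slP _ m2; rewrite -e in h2.
  have s0 : sl W1 != 0 by apply: contraNneq (vW _ m1) => s0; move: h1; rewrite s0 scale0r addr0.
  have : ~~ (w <= (W1 :&: W2) + v)%MS.
    apply: wn; rewrite mem_cat; apply/orP; right; apply/mapP; exists (W1, W2) => //.
    by rewrite mem_filter /= ne /=; apply/allpairsP; exists (W1, W2).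
  have ew : (sl W1)^-1 *: ((v + sl W1 *: w) - v) = w.
    by rewrite addrC addKr scalerA mulVf ?scale1r.
  case/negP; rewrite -ew scalemx_sub // submx_sub ?addsmxSr //.
  by apply: submx_trans (addsmxSl _ _); rewrite sub_capmx h1.
have g0 : line_poly f v w != 0.
  by apply: contraNneq fv => e; have := line_polyE f v w 0; rewrite scale0r addr0 e horner0 => <-.
rewrite -(size_map sl) -ltnS; apply: leq_trans fd; apply: leq_trans (size_line_poly f v w).
apply: max_poly_roots => //; last by rewrite map_inj_in_uniq // filter_uniq // subspaces_uniq.
apply/allP => _ /mapP[W WL ->]; rewrite /root line_polyE; apply/eqP.
by have [_ _ _] := LP _ WL; apply; exact: slP.
Qed.

(** * Rational points on a threefold *)

(** Chains of primes between the ideal of X and P have bounded length; the smallest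
    member of a longest one is a minimal prime. *)
Lemma component_below n (X : proj_variety n) (P : {pred {mpoly rat[n.+1]}}) :
  proj_prime P -> {subset variety_ideal X <= P} ->
  exists2 Q, irr_component X Q & {subset Q <= P}.
Proof.
move=> pP XP.
pose good r := `[< exists Q : nat -> {pred {mpoly rat[n.+1]}},
  [/\ forall i, (i <= r)%N -> proj_prime (Q i),
      forall i, (i < r)%N -> {subset Q i <= Q i.+1} /\ ~ {subset Q i.+1 <= Q i},
      {subset variety_ideal X <= Q 0%N} & {subset Q 0%N <= P}] >].
have exg : exists r, good r by exists 0%N; apply/asboolP; exists (fun _ => P); split.
have ubg r : good r -> (r <= n)%N.
  by move=> /asboolP[Q [pQ sQ _ _]]; apply: (@prime_chain_le n (Q 0%N)); exists Q.
case: (ex_maxnP exg ubg) => r /asboolP[Q [pQ sQ XQ QP]] rmax.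
exists (Q 0%N) => //; split=> //; first exact: pQ.
move=> Q' pQ' XQ' Q'Q f; apply/idP/idP; first exact: Q'Q.
apply: contrapT => /not_implyP[fQ fQ'].
have : (r.+1 <= r)%N; last by rewrite ltnn.
apply: rmax; apply/asboolP; exists (fun i => if i is i'.+1 then Q i' else Q'); split=> //.
- by case=> [|i] //; exact: pQ.
- case=> [|i] /=; last exact: sQ.
  by move=> _; split=> // h; apply: fQ'; exact: h.
- by move=> g /Q'Q /QP.
Qed.

Section PointIdeal.
Variables (n : nat) (x : 'rV[rat]_n.+1).

Definition point_tuple : n.+1.-tuple {mpoly rat[1]} := [tuple x 0 i *: 'X_0 | i < n.+1].

Lemma point_tuple_homog i : tnth point_tuple i \is 1.-homog.
Proof. by rewrite tnth_mktuple rpredZ // dhomogX /= mdeg1. Qed.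

Lemma point_eval f t : (f \mPo point_tuple).@[fun _ => t] = f.@[(t *: x) 0].
Proof.
rewrite comp_mpoly_meval; apply: meval_eq => i.
by rewrite tnth_mktuple mevalZ mevalXU mxE mulrC.
Qed.

Lemma mem_point_ideal f : (forall t, f.@[(t *: x) 0] = 0) <-> f \in subst_ker point_tuple.
Proof.
rewrite inE; split=> [h|/eqP h t]; last by rewrite -point_eval h meval0.
apply: contrapT => /negP/mpoly_nonvanishing[v] /eqP; apply.
rewrite -(h (v ord0)) -point_eval; apply: meval_eq => i; by rewrite ord1.
Qed.

Lemma point_ideal_prime : x != 0 -> proj_prime (subst_ker point_tuple).
Proof.
case/rV0Pn=> i xi; apply: (subst_ker_prime point_tuple_homog (i := i)).
by rewrite tnth_mktuple scaler_eq0 negb_or xi mpolyX_eq0.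
Qed.
End PointIdeal.

(** A rational point is a homogeneous prime containing the ideal of X, hence it contains
    the generator of one of the components. *)
Lemma variety_equation (X : proj_variety 4) d : pure_dim X 3 -> variety_degree X d ->
  exists F : {mpoly rat[5]}, [/\ F != 0, (msize F <= d.+1)%N &
    forall x : 'rV[rat]_5, x != 0 -> rat_point_on X <[x]>%VS -> forall t, F.@[(t *: x) 0] = 0].
Proof.
move=> dimX [k [Q [e [compQ allQ _ degQ ->]]]].
have /fin_all_exists[p hp] i : exists p : {mpoly rat[5]},
    [/\ p \is (e i).-homog, p != 0 & forall f, f \in Q i <-> divides p f].
  have [pQ _ _] := compQ i.
  have [D [p [homp p0 hp]]] := hypersurface_principal pQ (dimX _ (compQ i)).
  by exists p; rewrite (hypersurface_degree pQ (dimX _ (compQ i)) homp p0 hp (degQ i)).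
exists (\prod_i p i); have F0 : \prod_i p i != 0 by apply/prodf_neq0 => i _; have [] := hp i.
have homF : \prod_i p i \is (\sum_i e i)%N.-homog.
  elim/big_ind2: _ => [|f a g b hf hg|i _]; first exact: dhomog1.
    exact: dhomogM.
  by have [] := hp i.
split=> //.
  by rewrite (msize_dhomog F0 homF).
move=> x x0 [_ onX] t.
have XP : {subset variety_ideal X <= subst_ker (point_tuple x)}.
  move=> f fX; apply/mem_point_ideal => s; apply: onX => //.
  by apply/vlineP; exists s.
have [P compP PP] := component_below (point_ideal_prime x0) XP.
have [i eP] := allQ _ compP; have [_ _ hi] := hp i.
have : p i \in subst_ker (point_tuple x).
  by apply: PP; rewrite eP; apply/hi; exists 1; rewrite mul1r.
move=> /mem_point_ideal /(_ t) pt.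
by rewrite (bigD1 i) //= mevalM pt mul0r.
Qed.

Lemma height_le_maxminor k n (B : 'M[int]_(k, n)) (V : 'M[rat]_n) :
  row_free B^Q -> (B^Q :=: V)%MS -> (height V <= maxminor B)%N.
Proof.
move=> fB eB; have rV : \rank V = k by rewrite -eB (eqP fB).
have [A pA eA] := basisP rV.
have [Y eY] : exists Y, B = Y *m A by apply: primitive_rows_factor => //; rewrite eA eB.
have := maxminor_gt0 fB; rewrite (heightE pA eA) eY maxminorM.
by case: `|_|%N => [|m _]; rewrite ?mul0n // leq_pmull.
Qed.

Lemma height_line_le n (x : 'rV[int]_n) b : x != 0 -> (forall i, `|x 0%R i| <= b)%N ->
  (height <<x^Q>>%MS <= b)%N.
Proof.
move=> x0 xb.
have fx : row_free x^Q.
  rewrite /row_free rank_rV; suff -> : x^Q != 0 by [].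
  by apply: contra x0 => /eqP e; apply/eqP/mapQ_inj; rewrite e map_mx0.
apply: leq_trans (height_le_maxminor fx (eqmx_sym (genmxE _))) _.
by apply/bigmax_leqP => f _; rewrite det_mx11 mxE.
Qed.

Definition row_vspace n (V : 'M[rat]_n) : {vspace 'rV[rat]_n} := (\sum_i <[row i V]>)%VS.

Lemma row_vspace_line n (x : 'rV[rat]_n) : row_vspace <<x>>%MS = <[x]>%VS.
Proof.
apply/eqP; rewrite eqEsubv; apply/andP; split.
  apply/subv_sumP => i _; rewrite -memvE; apply/vlineP.
  have /submxP[c ->] : (row i <<x>> <= x)%MS by apply: submx_trans (row_sub _ _) _; rewrite genmxE.
  by exists (c 0 0); rewrite {1}[c]mx11_scalar mul_scalar_mx.
have /submxP[c e] : (x <= <<x>>)%MS by rewrite genmxE submx_refl.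
rewrite -memvE [X in X \in _]e mulmx_sum_row; apply: memv_suml => i _.
by apply: memvZ; rewrite memvE; apply: (sumv_sup i).
Qed.

Lemma rat_points_card (R : realType) (X : proj_variety 4) (B : R) F J :
  (forall x : 'rV[rat]_5, x != 0 -> rat_point_on X <[x]>%VS -> forall t, F.@[(t *: x) 0] = 0) ->
  0 <= B -> B < (2 ^ J.+1)%:R ->
  exists2 N, (rat_points X B #= `I_N)%card & (N <= count (vanishes F) (subspaces 5 1 (2 ^ J.+1).-1))%N.
Proof.
move=> FX B0 BJ; pose l := [seq V <- subspaces 5 1 (2 ^ J.+1).-1 | vanishes F V].
have sub : (rat_points X B `<=` (fun i => row_vspace (nth 0 l i)) @` `I_(size l))%classic.
  move=> L [onX [x [x0 xB eL]]]; have xQ0 : x^Q != 0.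
    by apply: contra x0 => /eqP e; apply/eqP/mapQ_inj; rewrite e map_mx0.
  have xl : <<x^Q>>%MS \in l.
    rewrite mem_filter mem_subspaces genmx_id eqxx genmxE rank_rV xQ0 /=; apply/andP; split.
      apply/asboolP => v; rewrite genmxE => /submxP[c ->].
      rewrite [c]mx11_scalar mul_scalar_mx; apply: FX => //.
      by move: onX; rewrite eL.
    apply: height_line_le => // i; rewrite -ltnS prednK ?expn_gt0 //.
    have := le_lt_trans (xB i) BJ; rewrite -(ltr_nat R) => h; apply: le_lt_trans h.
    by rewrite natr_absz.
  exists (index <<x^Q>>%MS l); first by rewrite /= index_mem.
  by rewrite nth_index // eL row_vspace_line.
have le : (rat_points X B #<= `I_(size l))%card.
  exact: card_le_trans (subset_card_le sub) (card_image_le _ _).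
have /finite_setP[N eN] : finite_set (rat_points X B) by apply/finite_set_leP; exists (size l).
exists N => //; rewrite -size_filter -card_le_II.
by rewrite -(card_le_eql eN).
Qed.

Lemma exists_dyadic_root d : (0 < d)%N -> exists tau, (d <= 2 ^ (5 * tau))%N /\
  (tau = 0%N \/ exists s, tau = s.+1 /\ (2 ^ (5 * s) < d)%N).
Proof.
move=> d0; have ex : exists tau, (d <= 2 ^ (5 * tau))%N.
  exists d; apply: leq_trans (ltnW (ltn_expl d (isT : 1 < 2)%N)) _.
  by rewrite leq_exp2l // leq_pmull.
case: (ex_minnP ex) => tau h hmin; exists tau; split=> //.
case: tau h hmin => [|s] h hmin; [by left | right; exists s; split=> //].
by rewrite ltnNge; apply/negP => /hmin; rewrite ltnn.
Qed.

Lemma pow_tau_le (R : realType) d tau : (0 < d)%N ->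
  (tau = 0%N \/ exists s, tau = s.+1 /\ (2 ^ (5 * s) < d)%N) ->
  ((2 ^ (4 * tau))%:R : R) <= 16 * d%:R `^ (48 / 55).
Proof.
move=> d0; have d1 : (1 : R) <= d%:R by rewrite ler1n.
have dp : (1 : R) <= d%:R `^ (48 / 55).
  by rewrite -[X in X <= _](powRr0 (d%:R : R)); apply: ler_powR => //; rewrite divr_ge0.
case=> [->|[s [-> hs]]]; first by rewrite muln0 expn0; lra.
rewrite mulnS expnD natrM ler_pM2l ?ltr0n //.
have two : (0 : R) <= 2 by [].
have y1 : (1 : R) <= (2 ^ s)%:R by rewrite ler1n expn_gt0.
apply: le_trans (_ : ((2 ^ (5 * s))%:R : R) `^ (48 / 55) <= _); last first.
  by apply: ge0_ler_powR; rewrite ?nnegrE ?ler0n ?divr_ge0 // ler_nat ltnW.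
rewrite (mulnC 5) (mulnC 4) !expnM natrX -powR_mulrn ?ler0n //.
rewrite (natrX _ (2 ^ s)%N 5) -powR_mulrn ?ler0n // -powRrM; apply: ler_powR => //.
lra.
Qed.

Theorem corollary3p12 (R : realType) :
  exists c kappa : R,
    forall (d : nat) (X : proj_variety 4) (B : R),
      (1 <= d)%N -> pure_dim X 3 -> variety_degree X d -> 2 <= B ->
      exists2 N : nat,
        (rat_points X B #= `I_N)%card &
        N%:R <= c * (d%:R `^ (48 / 55)) * B ^+ 4 * (ln B `^ kappa).
Proof.
have [C hC] := point_count_bound (isT : (1 < 5)%N).
exists (C%:R * 16), 0 => d X B d0 dimX degX B2.
have [F [F0 Fd FX]] := variety_equation dimX degX.
have [tau [dtau taud]] := exists_dyadic_root d0.
have B0 : 0 <= B by lra.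
have b0 : (0 < Num.truncn B)%N by rewrite truncn_gt0; lra.
pose J := trunc_log 2 (Num.truncn B).
have /andP[J1 J2] := trunc_log_bounds (isT : (1 < 2)%N) b0.
have BJ : B < (2 ^ J.+1)%:R by rewrite -truncn_lt_nat.
have JB : (2 ^ J)%:R <= B by rewrite -truncn_ge_nat.
have [N eN hN] := rat_points_card FX B0 BJ; exists N => //.
have nZ : ~~ vanishes F 1%:M.
  have [v hv] := mpoly_nonvanishing F0; apply/asboolPn => h.
  case/eqP: hv; rewrite -(h (\row_i v i)) ?submx1 //.
  by apply: meval_eq => i; rewrite mxE.
have := leq_trans hN (hC _ _ _ (vanishing_sections_bounded Fd) nZ dtau J).
rewrite -(ler_nat R) => /le_trans; apply.
rewrite powRr0 mulr1 natrM mulnDr expnD natrM -!mulrA; apply: ler_wpM2l; first exact: ler0n.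
rewrite mulrA; apply: ler_pM; rewrite ?ler0n //; first exact: pow_tau_le.
by rewrite mulnC expnM natrX; apply: lerXn2r; rewrite ?nnegrE ?ler0n.
Qed.
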